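(* Let $n\ge 1$ and let $f:\mathbb{H}^n\to\mathbb{H}$ be a holomorphic map with $f(\lambda,\ldots,\lambda)=\lambda$ for all $\lambda\in\mathbb{H}$. Let $\alpha_j=\frac{\partial f}{\partial z_j}(i,\ldots,i)$ for $j=1,\ldots,n$, and define $\mathbf{g}(z)=\sum_{j=1}^n\alpha_j z_j$ for $z=(z_1,\ldots,z_n)\in\mathbb{H}^n$. For $t\in\mathbb{R}$ let $f_t(z_1,\ldots,z_n)=f(z_1-t,\ldots,z_n-t)+t$. Fix $\varepsilon>0$, and let $U$ be any open neighborhood of $\mathbf{g}$ in the compact-open topology. Then for all sufficiently large $r$, the set $\{t\in[-\frac r2,\frac r2] : f_t\in U\}$ has Lebesgue measure at least $(1-\varepsilon)r$.
   Context: $\mathbb{H}=\{\lambda\in\mathbb{C}:\operatorname{Im}(\lambda)>0\}$ is the upper half-plane and $\mathbb{H}^n$ is its $n$-fold Cartesian product. The compact-open topology on the space $\mathcal{O}(\mathbb{H}^n)$ of holomorphic functions on $\mathbb{H}^n$ is the topology of uniform convergence on compact subsets. (In the situation of the claim, the $\alpha_j$ are nonnegative reals with sum $1$, so $\mathbf{g}$ maps $\mathbb{H}^n$ into $\mathbb{H}$.) *)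

(* Defs.v *)
From HB Require Import structures.
From mathcomp Require Import all_boot all_order all_algebra.
From mathcomp Require Import complex.
From mathcomp Require Import all_classical all_reals all_analysis.

Set Implicit Arguments.
Unset Strict Implicit.
Unset Printing Implicit Defensive.

Import Order.TTheory GRing.Theory Num.Theory.
Import numFieldNormedType.Exports.

Local Open Scope classical_set_scope.
Local Open Scope ring_scope.
Local Open Scope complex_scope.

(* R[i] is declared as a normed module over itself; without this only the
   alias R[i]^o carries the topology. *)
HB.instance Definition _ (R : realType) := NormedModule.copy R[i] R[i]^o.

Section Defs.
Variables (R : realType) (n : nat).

Definition upper_half_plane : set R[i] := [set l | 0 < complex.Im l].

(* Points of C^n are row vectors. *)
Definition upper_half_space : set 'rV[R[i]]_n :=
  [set z | forall j, upper_half_plane (z ord0 j)].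

(* Complex Frechet differentiability at each point of D; used for open D, so
   the values of F outside D are irrelevant. *)
Definition holomorphic_on (D : set 'rV[R[i]]_n) (F : 'rV[R[i]]_n -> R[i]) :=
  forall z, D z -> differentiable F z.

(* O(H^n), as a set of functions on the subtype H^n of C^n. Its topology is
   that of [subspace holomorphic_space], induced by the compact-open one. *)
Definition holomorphic_space :
    set {compact-open, upper_half_space -> R[i]} :=
  [set h | exists2 F, holomorphic_on upper_half_space F &
                      h = sigL upper_half_space F].

Definition partial_derivative (F : 'rV[R[i]]_n -> R[i]) (j : 'I_n)
  (z : 'rV[R[i]]_n) : R[i] := 'D_(delta_mx ord0 j) F z.

Definition translate (F : 'rV[R[i]]_n -> R[i]) (t : R) : 'rV[R[i]]_n -> R[i] :=
  fun z => F (z - const_mx t%:C) + t%:C.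

End Defs.

Arguments upper_half_plane : clear implicits.
Arguments upper_half_space : clear implicits.
Arguments holomorphic_space : clear implicits.

(* Main.v *)
Require Import Defs.
From mathcomp Require Import all_boot all_order all_algebra.
From mathcomp Require Import complex ring lra.
From mathcomp Require Import all_classical all_reals all_analysis.
From mathcomp Require Import measurable_realfun.
Import Order.TTheory GRing.Theory Num.Theory.
Import numFieldNormedType.Exports.
Local Open Scope classical_set_scope.
Local Open Scope ring_scope.
Local Open Scope complex_scope.

(* Write psi = f - g, so that f_t(w) - g(w) = psi(w - t).  Comparing f with the
   diagonal (Schwarz-Pick, Harnack) shows that the derivatives of f along the
   diagonal are real constants, that for fixed w the numbers psi(w + z), Im z >= 0,
   are bounded, and that psi(w + s + iY) tends to 0 as Y -> oo, uniformly in the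
   real shift s.  Shifting the contour upwards, the averages of psi(w - t) and of
   psi(w - t)^2 over long intervals of t tend to 0.  By Harnack,
   Im f(x + icy) <= c Im f(x + iy) for c >= 1: the averages of the
   nonnegative difference tend to 0, while Im psi(x + icy) / c, which hardly changes
   under a bounded shift, is bounded above by a small constant.  Hence the averages
   of |Im psi(w - t)| tend to 0, and since |psi|^2 = 2 (Im psi)^2 + Re (psi^2), so do those of
   |psi(w - t)|^2.  Markov's inequality and equicontinuity of the f_t on compact sets conclude. *)

Set Implicit Arguments.
Unset Strict Implicit.
Unset Printing Implicit Defensive.

(** Vanishing means of psi and of its square do not suffice: [exp (i z)] is bounded, decays upwards
    and has both means zero, yet its modulus is constant on horizontal lines. Positivity of Im f has
    to enter a second time, through the stretched points. Since g is linear with real coefficients,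
    subtracting it preserves Harnack's inequality, so that [y <= x], where [x] is Im psi at the
    point and [y] is Im psi at the stretched point divided by [c]. Together with [y <= e] this gives
    [|x| <= x - 2 y + 2 e], a majorant that is linear in quantities of vanishing mean. For [y <= e]
    the order of choices matters: first the length of a window on which the mean of [x] is small,
    then [c], so large that the window is short compared with the stretched height. *)

Local Notation cn := (@Normc.normc _).

(** * Modulus and derivatives on the complex plane *)

Section ComplexModulus.
Variable R : realType.
Implicit Types (x y z w : R[i]) (a b : R).

Lemma cn_ge0 z : 0 <= cn z.
Proof. by case: z => a b; exact: sqrtr_ge0. Qed.

Lemma sqr_cn z : cn z ^+ 2 = complex.Re z ^+ 2 + complex.Im z ^+ 2.
Proof. by case: z => a b; rewrite /= sqr_sqrtr // addr_ge0 // sqr_ge0. Qed.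

Lemma cn_le a z : 0 <= a -> (cn z <= a) = (complex.Re z ^+ 2 + complex.Im z ^+ 2 <= a ^+ 2).
Proof. by move=> a0; rewrite -sqr_cn ler_sqr ?nnegrE ?cn_ge0. Qed.

Lemma cn0 : cn (0 : R[i]) = 0. Proof. exact: Normc.normc0. Qed.
Lemma cn1 : cn (1 : R[i]) = 1. Proof. exact: Normc.normc1. Qed.
Lemma cnM x y : cn (x * y) = cn x * cn y. Proof. exact: Normc.normcM. Qed.
Lemma cnV x : cn x^-1 = (cn x)^-1. Proof. exact: Normc.normcV. Qed.
Lemma cnN x : cn (- x) = cn x. Proof. exact: normcN. Qed.
Lemma cnD x y : cn (x + y) <= cn x + cn y. Proof. exact: le_normcD. Qed.
Lemma cnB x y : cn (x - y) <= cn x + cn y.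
Proof. by rewrite -(cnN y); exact: cnD. Qed.
Lemma cn_distC x y : cn (x - y) = cn (y - x).
Proof. by rewrite -opprB cnN. Qed.
Lemma cn_triangle w x y : cn (x - y) <= cn (x - w) + cn (w - y).
Proof. by rewrite -[X in cn X <= _](subrKA w); exact: cnD. Qed.

Lemma cn_eq0 x : (cn x == 0) = (x == 0).
Proof.
apply/eqP/eqP => [|->]; [exact: Normc.eq0_normc | exact: cn0].
Qed.
Lemma cn_gt0 x : (0 < cn x) = (x != 0).
Proof. by rewrite lt_def cn_ge0 andbT cn_eq0. Qed.

Lemma cn_real a : cn a%:C = `|a|.
Proof. by rewrite /= expr0n /= addr0 sqrtr_sqr. Qed.

Lemma cn_i : cn ('i : R[i]) = 1.
Proof. by rewrite /= expr0n /= add0r expr1n sqrtr1. Qed.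

Lemma ler_Re_cn z : `|complex.Re z| <= cn z.
Proof.
rewrite -ler_sqr ?nnegrE ?cn_ge0 //.
by rewrite sqr_cn real_normK ?num_real // lerDl sqr_ge0.
Qed.
Lemma ler_Im_cn z : `|complex.Im z| <= cn z.
Proof.
rewrite -ler_sqr ?nnegrE ?cn_ge0 //.
by rewrite sqr_cn real_normK ?num_real // lerDr sqr_ge0.
Qed.
Lemma cn_le_ReIm z : cn z <= `|complex.Re z| + `|complex.Im z|.
Proof.
rewrite cn_le ?addr_ge0 // sqrrD !real_normK ?num_real //.
by rewrite addrAC lerDl mulrn_wge0 // mulr_ge0.
Qed.

Lemma cnX x n : cn (x ^+ n) = cn x ^+ n.
Proof. by elim: n => [|n IH]; rewrite ?expr0 ?cn1 // !exprS cnM IH. Qed.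

Lemma ReD x y : complex.Re (x + y) = complex.Re x + complex.Re y.
Proof. by case: x y => ? ? []. Qed.
Lemma ImD x y : complex.Im (x + y) = complex.Im x + complex.Im y.
Proof. by case: x y => ? ? []. Qed.
Lemma ReN x : complex.Re (- x) = - complex.Re x.
Proof. by case: x. Qed.
Lemma ImN x : complex.Im (- x) = - complex.Im x.
Proof. by case: x. Qed.
Lemma ReB x y : complex.Re (x - y) = complex.Re x - complex.Re y.
Proof. by rewrite ReD ReN. Qed.
Lemma ImB x y : complex.Im (x - y) = complex.Im x - complex.Im y.
Proof. by rewrite ImD ImN. Qed.
Lemma ReM x y : complex.Re (x * y) =
  complex.Re x * complex.Re y - complex.Im x * complex.Im y.
Proof. by case: x y => ? ? []. Qed.
Lemma ImM x y : complex.Im (x * y) =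
  complex.Re x * complex.Im y + complex.Im x * complex.Re y.
Proof. by case: x y => ? ? [] ? ? /=; rewrite [RHS]addrC addrC. Qed.
Lemma ImZ a z : complex.Im (a%:C * z) = a * complex.Im z.
Proof. by rewrite ImM /= mul0r addr0. Qed.

Lemma complex_ext x y :
  complex.Re x = complex.Re y -> complex.Im x = complex.Im y -> x = y.
Proof. by case: x y => ? ? [] ? ? /= -> ->. Qed.

End ComplexModulus.

Section ComplexCalculus.
Variable R : realType.
Implicit Types (z w : R[i]) (F G S T : R[i] -> R[i]).

(** Spelled out with the real-valued modulus [cn], because the norm of [R[i]] takes its values in
    [R[i]]. *)
Definition ccont S z := forall e : R, 0 < e ->
  exists2 d : R, 0 < d & forall w, cn (w - z) < d -> cn (S w - S z) < e.

(* Caratheodory's form of differentiability: the difference quotient extends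
   continuously to [z]. *)
Definition cdiff G z a := exists S,
  [/\ ccont S z, S z = a & forall w, G w - G z = S w * (w - z)].

Lemma ccont_cst c z : ccont (fun=> c) z.
Proof. by move=> e e0; exists 1 => // w _; rewrite subrr cn0. Qed.

Lemma ccont_id z : ccont id z.
Proof. by move=> e e0; exists e. Qed.

Lemma ccont_ext F G z (d : R) : 0 < d ->
  (forall w, cn (w - z) < d -> F w = G w) -> ccont F z -> ccont G z.
Proof.
move=> d0 FG cF e e0; have [d' d'0 H] := cF e e0.
exists (Num.min d d'); first by rewrite lt_min d0.
move=> w; rewrite lt_min => /andP[wd wd']; rewrite -!FG ?H //.
by rewrite subrr cn0.
Qed.

Lemma ccontD F G z : ccont F z -> ccont G z -> ccont (fun w => F w + G w) z.
Proof.
move=> cF cG e e0; have e2 : 0 < e / 2 by rewrite divr_gt0.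
have [d d0 H] := cF _ e2; have [d' d'0 H'] := cG _ e2.
exists (Num.min d d'); first by rewrite lt_min d0.
move=> w; rewrite lt_min => /andP[/H wd /H' wd'].
by rewrite opprD addrACA (le_lt_trans (cnD _ _)) // [e]splitr ltrD.
Qed.

Lemma ccont_comp F G z : ccont F z -> ccont G (F z) -> ccont (fun w => G (F w)) z.
Proof.
move=> cF cG e e0; have [d d0 H] := cG _ e0; have [d' d'0 H'] := cF _ d0.
by exists d' => // w /H' /H.
Qed.

Lemma ccont_bounded F z : ccont F z ->
  exists2 d : R, 0 < d & forall w, cn (w - z) < d -> cn (F w) < cn (F z) + 1.
Proof.
move=> /(_ 1 ltr01) [d d0 H]; exists d => // w /H h.
by rewrite -[F w](subrK (F z)) (le_lt_trans (cnD _ _)) // addrC ltrD2l.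
Qed.

Lemma ccontM F G z : ccont F z -> ccont G z -> ccont (fun w => F w * G w) z.
Proof.
move=> cF cG e e0.
have [d d0 H] := ccont_bounded cF.
set M := cn (F z) + 1; set N := cn (G z) + 1.
have M0 : 0 < M by rewrite ltr_wpDl ?cn_ge0.
have N0 : 0 < N by rewrite ltr_wpDl ?cn_ge0.
have [d1 d10 H1] := cF (e / 2 / N) ltac:(by rewrite !divr_gt0).
have [d2 d20 H2] := cG (e / 2 / M) ltac:(by rewrite !divr_gt0).
exists (Num.min d (Num.min d1 d2)); first by rewrite !lt_min d0 d10.
move=> w; rewrite !lt_min => /and3P[/H wd /H1 wd1 /H2 wd2].
have -> : F w * G w - F z * G z = F w * (G w - G z) + (F w - F z) * G z by ring.
rewrite (le_lt_trans (cnD _ _)) // !cnM [e]splitr ltrD //.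
  rewrite -(divfK (lt0r_neq0 M0) (e / 2)) mulrC.
  rewrite (le_lt_trans (ler_wpM2l (cn_ge0 _) (ltW wd))) //.
  by rewrite ltr_pM2r.
rewrite -(divfK (lt0r_neq0 N0) (e / 2)).
apply: (@le_lt_trans _ _ (cn (F w - F z) * N)).
  by rewrite ler_wpM2l ?cn_ge0 // lerDl.
by rewrite ltr_pM2r.
Qed.

Lemma ccontN F z : ccont F z -> ccont (fun w => - F w) z.
Proof.
move=> cF e /cF [d d0 H]; exists d => // w /H.
by rewrite -opprD cnN.
Qed.

Lemma ccontB F G z : ccont F z -> ccont G z -> ccont (fun w => F w - G w) z.
Proof. by move=> cF /ccontN; exact: ccontD. Qed.

Lemma ccontV F z : ccont F z -> F z != 0 -> ccont (fun w => (F w)^-1) z.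
Proof.
move=> cF Fz0 e e0; have c0 : 0 < cn (F z) by rewrite cn_gt0.
have [d d0 H] := cF (cn (F z) / 2) ltac:(by rewrite divr_gt0).
have [d' d'0 H'] := cF (e * cn (F z) ^+ 2 / 2)
  ltac:(by rewrite divr_gt0 // mulr_gt0 // exprn_gt0).
exists (Num.min d d'); first by rewrite lt_min d0.
move=> w; rewrite lt_min => /andP[/H wd /H' wd'].
have cw : cn (F z) / 2 < cn (F w).
  have := cn_triangle (F w) (F z) 0; rewrite !subr0 cn_distC.
  move: wd; move: (cn _) (cn (F z)) (cn (F w)) => p q r; lra.
have cw0 : 0 < cn (F w) by rewrite (lt_trans _ cw) // divr_gt0.
have Fw0 : F w != 0 by rewrite -cn_gt0.
have -> : (F w)^-1 - (F z)^-1 = - (F w - F z) / (F w * F z).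
  by field; rewrite Fw0 Fz0.
rewrite cnM cnN cnV cnM ltr_pdivrMr ?mulr_gt0 //.
apply: (lt_trans wd').
have -> : e * cn (F z) ^+ 2 / 2 = e * (cn (F z) / 2 * cn (F z)) by ring.
by rewrite ltr_pM2l // ltr_pM2r.
Qed.

Lemma cdiff_ccont F z a : cdiff F z a -> ccont F z.
Proof.
move=> [S [cS _ H]].
have cH : ccont (fun w => F z + S w * (w - z)) z.
  apply: ccontD; first exact: ccont_cst.
  by apply: ccontM => //; apply: ccontB; [exact: ccont_id | exact: ccont_cst].
by apply: (ccont_ext ltr01 _ cH) => w _; rewrite -H addrC subrK.
Qed.

Lemma cdiff_cst c z : cdiff (fun=> c) z 0.
Proof.
by exists (fun=> 0); split=> [||w]; [exact: ccont_cst| |rewrite subrr mul0r].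
Qed.

Lemma cdiff_id z : cdiff id z 1.
Proof.
by exists (fun=> 1); split=> [||w]; [exact: ccont_cst| |rewrite mul1r].
Qed.

Lemma cdiffD F G z a b : cdiff F z a -> cdiff G z b ->
  cdiff (fun w => F w + G w) z (a + b).
Proof.
move=> [S [cS <- HS]] [T [cT <- HT]]; exists (fun w => S w + T w); split => //.
- exact: ccontD.
- by move=> w; rewrite mulrDl -HS -HT opprD addrACA.
Qed.

Lemma cdiffM F G z a b : cdiff F z a -> cdiff G z b ->
  cdiff (fun w => F w * G w) z (a * G z + F z * b).
Proof.
move=> dF dG; have cF := cdiff_ccont dF; have cG := cdiff_ccont dG.
move: dF dG => [S [cS <- HS]] [T [cT <- HT]].
exists (fun w => S w * G w + F z * T w); split => //.
- apply: ccontD; first exact: ccontM.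
  by apply: ccontM => //; exact: ccont_cst.
- move=> w; rewrite mulrDl mulrAC -HS -mulrA -HT; ring.
Qed.

Lemma cdiffN F z a : cdiff F z a -> cdiff (fun w => - F w) z (- a).
Proof.
move=> [S [cS <- HS]]; exists (fun w => - S w); split => //.
- exact: ccontN.
- by move=> w; rewrite mulNr -HS opprD.
Qed.

Lemma cdiffB F G z a b : cdiff F z a -> cdiff G z b ->
  cdiff (fun w => F w - G w) z (a - b).
Proof. by move=> dF /cdiffN; exact: cdiffD. Qed.

Lemma cdiffV F z a : cdiff F z a -> F z != 0 ->
  cdiff (fun w => (F w)^-1) z (- a / (F z) ^+ 2).
Proof.
move=> dF Fz0; have cF := cdiff_ccont dF; move: dF => [S [cS <- HS]].
(* Near [z] the difference quotient is [- S w / (F w * F z)]; where [F w = 0] the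
   junk inverse forces another value. *)
exists (fun w => if F w == 0 then - (F z)^-1 / (w - z) else - S w / (F w * F z)).
have [d d0 Hd] := cF (cn (F z)) ltac:(by rewrite cn_gt0).
have Fw0 w : cn (w - z) < d -> F w != 0.
  move=> /Hd; apply: contraTneq => ->.
  by rewrite sub0r cnN ltxx.
split.
- apply: (@ccont_ext (fun w => - S w / (F w * F z)) _ _ d) => //.
    by move=> w /Fw0 /negPf ->.
  apply: ccontM; first exact: ccontN.
  apply: ccontV; last by rewrite mulf_neq0.
  by apply: ccontM => //; exact: ccont_cst.
- by rewrite (negPf Fz0) expr2.
- move=> w; case: ifPn => [/eqP Fw|Fw].
    rewrite Fw invr0 sub0r divfK // subr_eq0; apply: contraNneq Fz0 => <-.
    by rewrite Fw.
  have -> : - S w / (F w * F z) * (w - z) = - (S w * (w - z)) / (F w * F z) by ring.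
  by rewrite -HS; field; rewrite Fw Fz0.
Qed.

Lemma cdiff_comp F G z a b : cdiff F z a -> cdiff G (F z) b ->
  cdiff (fun w => G (F w)) z (b * a).
Proof.
move=> dF; have cF := cdiff_ccont dF; move: dF => [S [cS <- HS]] [T [cT <- HT]].
exists (fun w => T (F w) * S w); split => //.
- by apply: ccontM => //; exact: (ccont_comp cF cT).
- by move=> w; rewrite HT HS mulrA.
Qed.

Lemma cdiffX F z a n : cdiff F z a -> exists b, cdiff (fun w => F w ^+ n) z b.
Proof.
move=> dF; elim: n => [|n [b IH]].
  by exists 0; under eq_fun do rewrite expr0; exact: cdiff_cst.
by eexists; under eq_fun do rewrite exprS; apply: cdiffM; eauto.
Qed.

(** The difference quotient with its singularity at [p] filled in; this is how zeros and poles are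
    divided out in the Schwarz and Cauchy arguments. *)
Definition slope F p a w := if w == p then a else (F w - F p) / (w - p).

Lemma slopeE F p a w : F w - F p = slope F p a w * (w - p).
Proof.
rewrite /slope; case: eqVneq => [->|wp]; first by rewrite !subrr mulr0.
by rewrite divfK // subr_eq0.
Qed.

Lemma ccont_slope F p a : cdiff F p a -> ccont (slope F p a) p.
Proof.
move=> [S [cS <- HS]]; apply: (ccont_ext ltr01 _ cS) => w _.
rewrite /slope; case: eqVneq => [->//|wp].
by rewrite HS mulfK // subr_eq0.
Qed.

(** The factor witnessing [cdiff F z a] need not serve [G] far from [z], so the slope of [G] itself
    replaces it. *)
Lemma cdiff_ext F G z a (d : R) : 0 < d ->
  (forall w, cn (w - z) < d -> F w = G w) -> cdiff F z a -> cdiff G z a.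
Proof.
move=> d0 FG dF; exists (slope G z a); split.
- apply: (ccont_ext d0 _ (ccont_slope dF)) => w wd.
  by rewrite /slope FG // FG // subrr cn0.
- by rewrite /slope eqxx.
- exact: slopeE.
Qed.

Lemma cdiff_slope F p a w b : w != p -> cdiff F w b ->
  exists c, cdiff (slope F p a) w c.
Proof.
move=> wp dF; eexists.
apply: (@cdiff_ext (fun w => (F w - F p) / (w - p)) _ _ _ (cn (w - p))).
- by rewrite cn_gt0 subr_eq0.
- move=> v; rewrite /slope; case: eqVneq => // ->.
  by rewrite cn_distC ltxx.
- apply: cdiffM; first by apply: cdiffB; [exact: dF | exact: cdiff_cst].
  apply: cdiffV; last by rewrite subr_eq0.
  by apply: cdiffB; [exact: cdiff_id | exact: cdiff_cst].
Qed.

End ComplexCalculus.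

(** * Integrals along segments *)

Section SegmentIntegral.
Variable R : realType.
Implicit Types (f g : R -> R) (F G : R -> R[i]) (a b m : R).

(** A Lebesgue integral, so that Markov's inequality applies to it directly at the end. *)
Definition rint f a b : R := (\int[lebesgue_measure]_(t in `[a, b]) f t)%R.

(** Continuity is two-sided even at the endpoints, so it restricts to subsegments without further
    argument. *)
Definition rcontinuous_on a b f := forall t, a <= t <= b -> {for t, continuous f}.

Lemma rcontinuous_integrable a b f : rcontinuous_on a b f ->
  lebesgue_measure.-integrable `[a, b] (EFin \o f).
Proof.
move=> H; apply: continuous_compact_integrable; first exact: segment_compact.
apply: continuous_in_subspaceT => t; rewrite inE /= in_itv /=; exact: H.
Qed.

Lemma eq_rint a b f g : (forall t, a <= t <= b -> f t = g t) -> rint f a b = rint g a b.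
Proof.
by move=> fg; apply: eq_Rintegral => t; rewrite inE /= in_itv /=; exact: fg.
Qed.

Lemma rintD a b f g : rcontinuous_on a b f -> rcontinuous_on a b g ->
  rint (fun t => f t + g t) a b = rint f a b + rint g a b.
Proof. by move=> cf cg; apply: RintegralD => //; exact: rcontinuous_integrable. Qed.

Lemma rintB a b f g : rcontinuous_on a b f -> rcontinuous_on a b g ->
  rint (fun t => f t - g t) a b = rint f a b - rint g a b.
Proof. by move=> cf cg; apply: RintegralB => //; exact: rcontinuous_integrable. Qed.

Lemma rintZ a b (k : R) f : rcontinuous_on a b f ->
  rint (fun t => k * f t) a b = k * rint f a b.
Proof. by move=> cf; apply: RintegralZl => //; exact: rcontinuous_integrable. Qed.

Lemma rint_cst a b (k : R) : a <= b -> rint (fun=> k) a b = k * (b - a).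
Proof.
move=> ab; rewrite /rint Rintegral_cst //.
congr (_ * _); apply: (etrans (congr1 fine (lebesgue_measure_itv `[a, b]))).
by rewrite /= lte_fin; case: ltgtP ab => // -> _; rewrite subrr.
Qed.

Lemma ler_rint a b f g : rcontinuous_on a b f -> rcontinuous_on a b g ->
  (forall t, a <= t <= b -> f t <= g t) -> rint f a b <= rint g a b.
Proof.
move=> cf cg fg; apply: le_Rintegral.
- exact: measurable_itv.
- exact: rcontinuous_integrable.
- exact: rcontinuous_integrable.
- by move=> t; rewrite /= in_itv /=; exact: fg.
Qed.

Lemma rint_split a m b f : a <= m -> m <= b -> rcontinuous_on a b f ->
  rint f a b = rint f a m + rint f m b.
Proof.
move=> am mb cf; have If := rcontinuous_integrable cf.
suff <- : rint f a b - rint f a m = rint f m b by rewrite addrC subrK.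
apply: (etrans (Rintegral_itvB If _ _)); rewrite ?bnd_simp //.
apply: Rintegral_itv_obnd_cbnd.
by apply: integrableS If => //; apply: subset_itvr; rewrite bnd_simp.
Qed.

Lemma rcontinuous_cst a b (k : R) : rcontinuous_on a b (fun=> k).
Proof. by move=> t _; exact: cst_continuous. Qed.

Lemma rint_ge a b (k : R) f : a <= b -> rcontinuous_on a b f ->
  (forall t, a <= t <= b -> k <= f t) -> k * (b - a) <= rint f a b.
Proof.
move=> ab cf H; rewrite -rint_cst //; apply: ler_rint => //.
exact: rcontinuous_cst.
Qed.

Lemma rint_le a b (k : R) f : a <= b -> rcontinuous_on a b f ->
  (forall t, a <= t <= b -> f t <= k) -> rint f a b <= k * (b - a).
Proof.
move=> ab cf H; rewrite -rint_cst //; apply: ler_rint => //.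
exact: rcontinuous_cst.
Qed.

Definition pcont F (t : R) := forall e : R, 0 < e ->
  exists2 d : R, 0 < d & forall s, `|s - t| < d -> cn (F s - F t) < e.

Definition pcont_on a b F := forall t, a <= t <= b -> pcont F t.

Lemma pcontP f (t : R) : {for t, continuous f} <-> forall e : R, 0 < e ->
  exists2 d : R, 0 < d & forall s, `|s - t| < d -> `|f s - f t| < e.
Proof.
split=> [/cvgrPdist_lt H e e0|H].
  have /nbhs_normP[d /= d0 Hd] := H _ e0.
  exists d => // s sd; rewrite distrC; apply: Hd.
  by rewrite /ball_ /= distrC.
apply/cvgrPdist_lt => e e0; have [d d0 Hd] := H e e0.
apply/nbhs_normP; exists d => //= s.
by rewrite /ball_ /= distrC => /Hd; rewrite distrC.
Qed.

Lemma pcont_Re F t : pcont F t -> {for t, continuous (fun s => complex.Re (F s))}.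
Proof.
move=> H; apply/pcontP => e /H [d d0 Hd]; exists d => // s /Hd.
by rewrite -ReB; exact: le_lt_trans (ler_Re_cn _).
Qed.

Lemma pcont_Im F t : pcont F t -> {for t, continuous (fun s => complex.Im (F s))}.
Proof.
move=> H; apply/pcontP => e /H [d d0 Hd]; exists d => // s /Hd.
by rewrite -ImB; exact: le_lt_trans (ler_Im_cn _).
Qed.

Lemma pcont_on_Re a b F : pcont_on a b F -> rcontinuous_on a b (fun s => complex.Re (F s)).
Proof. by move=> H t /H; exact: pcont_Re. Qed.
Lemma pcont_on_Im a b F : pcont_on a b F -> rcontinuous_on a b (fun s => complex.Im (F s)).
Proof. by move=> H t /H; exact: pcont_Im. Qed.

Lemma pcont_path (S : R[i] -> R[i]) (p : R -> R[i]) t :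
  (forall s, cn (p s - p t) <= `|s - t|) -> ccont S (p t) ->
  pcont (fun s => S (p s)) t.
Proof.
move=> Hp cS e /cS [d d0 Hd]; exists d => // s sd.
by apply: Hd; exact: le_lt_trans (Hp s) sd.
Qed.

Lemma pcontB F G t : pcont F t -> pcont G t -> pcont (fun s => F s - G s) t.
Proof.
move=> cF cG e e0; have e2 : 0 < e / 2 by rewrite divr_gt0.
have [d d0 H] := cF _ e2; have [d' d'0 H'] := cG _ e2.
exists (Num.min d d'); first by rewrite lt_min d0.
move=> w; rewrite lt_min => /andP[/H wd /H' wd'].
have -> : F w - G w - (F t - G t) = (F w - F t) - (G w - G t) by ring.
by rewrite (le_lt_trans (cnB _ _)) // [e]splitr ltrD.
Qed.

Definition cint F a b : R[i] :=
  rint (fun t => complex.Re (F t)) a b +i* rint (fun t => complex.Im (F t)) a b.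

Lemma cintB a b F G : pcont_on a b F -> pcont_on a b G ->
  cint (fun t => F t - G t) a b = cint F a b - cint G a b.
Proof.
move=> cF cG; apply: complex_ext; rewrite ?ReB ?ImB /cint /= -rintB.
- by apply: eq_rint => t _; rewrite ReB.
- exact: pcont_on_Re.
- exact: pcont_on_Re.
- by apply: eq_rint => t _; rewrite ImB.
- exact: pcont_on_Im.
- exact: pcont_on_Im.
Qed.

Lemma eq_cint a b F G : (forall t, a <= t <= b -> F t = G t) -> cint F a b = cint G a b.
Proof. by move=> FG; congr (_ +i* _); apply: eq_rint => t /FG ->. Qed.

Lemma cint_cst a b (k : R[i]) : a <= b -> cint (fun=> k) a b = k * (b - a)%:C.
Proof.
move=> ab; rewrite /cint !rint_cst //; apply: complex_ext.
  by rewrite ReM /= mulr0 subr0.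
by rewrite ImM /= mulr0 add0r.
Qed.

Lemma cint_split a m b F : a <= m -> m <= b -> pcont_on a b F ->
  cint F a b = cint F a m + cint F m b.
Proof.
move=> am mb cF; apply: complex_ext; rewrite ?ReD ?ImD /cint /=; apply: rint_split => //.
  exact: pcont_on_Re.
exact: pcont_on_Im.
Qed.

(** The factor 2 comes from bounding the real and imaginary parts separately. *)
Lemma cn_cint_le a b (M : R) F : a <= b -> pcont_on a b F ->
  (forall t, a <= t <= b -> cn (F t) <= M) -> cn (cint F a b) <= 2 * M * (b - a).
Proof.
move=> ab cF H.
have b1 f : rcontinuous_on a b f -> (forall t, a <= t <= b -> `|f t| <= M) ->
    `|rint f a b| <= M * (b - a).
  move=> cf Hf; rewrite ler_norml -mulNr rint_ge ?rint_le //.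
  - by move=> t /Hf; rewrite ler_norml => /andP[].
  - by move=> t /Hf; rewrite ler_norml => /andP[].
apply: (le_trans (cn_le_ReIm _)); rewrite /cint /= -mulrA mulr2n mulrDl mul1r.
apply: lerD; apply: b1.
- exact: pcont_on_Re.
- by move=> t /H; exact: le_trans (ler_Re_cn _).
- exact: pcont_on_Im.
- by move=> t /H; exact: le_trans (ler_Im_cn _).
Qed.

End SegmentIntegral.

(** * Goursat's theorem on rectangles *)

Section Goursat.
Variable R : realType.
Implicit Types (G : R[i] -> R[i]) (z w : R[i]) (a b c d m x y : R).

Definition in_rect a b c d z :=
  (a <= complex.Re z <= b) && (c <= complex.Im z <= d).

(** The counterclockwise contour integral of [G], with opposite sides paired; the factor ['i] is
    [dz = i dy] on the vertical sides. *)
Definition rect G a b c d : R[i] :=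
  cint (fun x => G (x +i* c) - G (x +i* d)) a b +
  'i * cint (fun y => G (b +i* y) - G (a +i* y)) c d.

Lemma in_rect_sub a b c d a' b' c' d' z : a <= a' -> b' <= b -> c <= c' -> d' <= d ->
  in_rect a' b' c' d' z -> in_rect a b c d z.
Proof.
move=> aa bb cc dd /andP[/andP[h1 h2] /andP[h3 h4]]; rewrite /in_rect.
by rewrite (le_trans aa h1) (le_trans h2 bb) (le_trans cc h3) (le_trans h4 dd).
Qed.

Lemma pcont_h G y x : ccont G (x +i* y) -> pcont (fun s => G (s +i* y)) x.
Proof.
apply: (@pcont_path R G (fun s => s +i* y)) => s.
by rewrite -cn_real; rewrite le_eqVlt; apply/orP; left; apply/eqP; congr cn; apply: complex_ext; rewrite ?ReB ?ImB /= ?subrr.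
Qed.

Lemma pcont_v G x y : ccont G (x +i* y) -> pcont (fun s => G (x +i* s)) y.
Proof.
apply: (@pcont_path R G (fun s => x +i* s)) => s.
rewrite -cn_real -[X in _ <= X]mul1r -cn_i -cnM.
rewrite le_eqVlt; apply/orP; left; apply/eqP; congr cn; apply: complex_ext; rewrite ?ReB ?ImB ?ReM ?ImM /= ?subrr.
  by rewrite mul0r mulr0 subr0.
by rewrite mul0r mul1r add0r.
Qed.

Lemma pcont_on_h G a b c d y : (forall z, in_rect a b c d z -> ccont G z) ->
  c <= y <= d -> pcont_on a b (fun s => G (s +i* y)).
Proof. by move=> H yd x xb; apply/pcont_h/H; rewrite /in_rect /= xb yd. Qed.

Lemma pcont_on_v G a b c d x : (forall z, in_rect a b c d z -> ccont G z) ->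
  a <= x <= b -> pcont_on c d (fun s => G (x +i* s)).
Proof. by move=> H xb y yd; apply/pcont_v/H; rewrite /in_rect /= xb yd. Qed.

Lemma pcont_onB a b (F G : R -> R[i]) : pcont_on a b F -> pcont_on a b G ->
  pcont_on a b (fun t => F t - G t).
Proof. by move=> cF cG t tab; apply: pcontB; [exact: cF | exact: cG]. Qed.

Lemma rect_splitx G a m b c d : a <= m -> m <= b -> c <= d ->
  (forall z, in_rect a b c d z -> ccont G z) ->
  rect G a b c d = rect G a m c d + rect G m b c d.
Proof.
move=> am mb cd H; rewrite /rect.
have cc : c <= c <= d by rewrite lexx.
have dd : c <= d <= d by rewrite cd lexx.
have aa : a <= a <= b by rewrite lexx (le_trans am).
have bb : a <= b <= b by rewrite lexx (le_trans am).
have mm : a <= m <= b by rewrite am.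
rewrite (@cint_split _ a m b) //; last first.
  by apply: pcont_onB; exact: (pcont_on_h H).
rewrite !(@cintB _ c d); try exact: (pcont_on_v H).
ring.
Qed.

Lemma rect_splity G a b c m d : a <= b -> c <= m -> m <= d ->
  (forall z, in_rect a b c d z -> ccont G z) ->
  rect G a b c d = rect G a b c m + rect G a b m d.
Proof.
move=> ab cm md H; rewrite /rect.
have cc : c <= c <= d by rewrite lexx (le_trans cm).
have dd : c <= d <= d by rewrite lexx (le_trans cm).
have aa : a <= a <= b by rewrite lexx.
have bb : a <= b <= b by rewrite lexx ab.
have mm : c <= m <= d by rewrite cm.
rewrite (@cint_split _ c m d) //; last first.
  by apply: pcont_onB; exact: (pcont_on_v H).
rewrite !(@cintB _ a b); try exact: (pcont_on_h H).
ring.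
Qed.

(* The rectangle integral of an affine function vanishes, so only the distance to one
   matters. *)
Lemma cn_rect_affine G a b c d z0 A B (eta : R) : a <= b -> c <= d ->
  (forall z, in_rect a b c d z -> ccont G z) ->
  (forall z, in_rect a b c d z -> cn (G z - (A + B * (z - z0))) <= eta) ->
  cn (rect G a b c d) <= 4 * eta * ((b - a) + (d - c)).
Proof.
move=> ab cd H Heta.
have cc : c <= c <= d by rewrite lexx.
have dd : c <= d <= d by rewrite cd lexx.
have aa : a <= a <= b by rewrite lexx.
have bb : a <= b <= b by rewrite ab lexx.
(* [k] and [k'] are the differences of the affine function between opposite sides. They are
   constant, and [k * (b - a) + 'i * k' * (d - c) = 0]. *)
set k := - ('i * B * (d - c)%:C); set k' := B * (b - a)%:C.
have cst k0 : pcont_on a b (fun=> k0) /\ pcont_on c d (fun=> k0).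
  by split=> t _ e e0; exists 1 => // s _; rewrite subrr cn0.
have ch := pcont_onB (pcont_on_h H cc) (pcont_on_h H dd).
have cv := pcont_onB (pcont_on_v H bb) (pcont_on_v H aa).
have -> : rect G a b c d =
    cint (fun x => (G (x +i* c) - G (x +i* d)) - k) a b +
    'i * cint (fun y => (G (b +i* y) - G (a +i* y)) - k') c d.
  rewrite (cintB ch (cst _).1) (cintB cv (cst _).2) !cint_cst // /rect /k /k'.
  ring.
apply: (le_trans (cnD _ _)); rewrite cnM cn_i mul1r mulrDr.
have two (u v u' v' l : R[i]) : cn (u - u') <= eta -> cn (v - v') <= eta ->
    u' - v' = l -> cn (u - v - l) <= 2 * eta.
  move=> hu hv <-; have -> : u - v - (u' - v') = (u - u') - (v - v') by ring.
  by apply: (le_trans (cnB _ _)); rewrite mulr2n mulrDl mul1r lerD.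
have -> : 4 * eta = 2 * (2 * eta) by ring.
apply: lerD; apply: cn_cint_le => //.
- exact: pcont_onB ch (cst _).1.
- move=> x xb; apply: (two _ _ (A + B * (x +i* c - z0)) (A + B * (x +i* d - z0))).
  + by apply: Heta; rewrite /in_rect /= xb cc.
  + by apply: Heta; rewrite /in_rect /= xb dd.
  + rewrite /k; have -> : (x +i* d) = (x +i* c) + 'i * (d - c)%:C.
      by apply: complex_ext; rewrite ?ReD ?ImD ?ReM ?ImM /=; ring.
    ring.
- exact: pcont_onB cv (cst _).2.
- move=> y yd; apply: (two _ _ (A + B * (b +i* y - z0)) (A + B * (a +i* y - z0))).
  + by apply: Heta; rewrite /in_rect /= yd bb.
  + by apply: Heta; rewrite /in_rect /= yd aa.
  + rewrite /k'; have -> : (b +i* y) = (a +i* y) + (b - a)%:C.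
      by apply: complex_ext; rewrite ?ReD ?ImD /=; ring.
    ring.
Qed.

Lemma cn_in_rect_le a b c d z w : in_rect a b c d z -> in_rect a b c d w ->
  cn (z - w) <= (b - a) + (d - c).
Proof.
move=> /andP[/andP[h1 h2] /andP[h3 h4]] /andP[/andP[h5 h6] /andP[h7 h8]].
apply: (le_trans (cn_le_ReIm _)); rewrite ReB ImB.
by apply: lerD; rewrite ler_norml; apply/andP; split; lra.
Qed.

(** The four quarters add up to the whole, so one of them carries more than a quarter of the bound.
    The lower bound [e] is a parameter so that the step can be iterated. *)
Lemma goursat_step G a b c d (e : R) : 0 <= e -> a <= b -> c <= d ->
  (forall z, in_rect a b c d z -> ccont G z) ->
  e < cn (rect G a b c d) -> exists u : R * R,
    [/\ (u.1 = a \/ u.1 = (a + b) / 2), (u.2 = c \/ u.2 = (c + d) / 2) &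
      e / 4 < cn (rect G u.1 (u.1 + (b - a) / 2) u.2 (u.2 + (d - c) / 2))].
Proof.
move=> e0 ab cd H; set m := (a + b) / 2; set n := (c + d) / 2.
have [am mb cn' nd] : [/\ a <= m, m <= b, c <= n & n <= d] by rewrite /m /n; split; lra.
have e1 : a + (b - a) / 2 = m by rewrite /m; field.
have e2 : m + (b - a) / 2 = b by rewrite /m; field.
have e3 : c + (d - c) / 2 = n by rewrite /n; field.
have e4 : n + (d - c) / 2 = d by rewrite /n; field.
rewrite (rect_splitx am mb cd H).
rewrite (rect_splity am cn' nd); last by move=> z /(in_rect_sub (lexx _) mb (lexx _) (lexx _))/H.
rewrite (rect_splity mb cn' nd); last by move=> z /(in_rect_sub am (lexx _) (lexx _) (lexx _))/H.
move=> he; apply: contrapT => hn.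
have small u : (u.1 = a \/ u.1 = m) -> (u.2 = c \/ u.2 = n) ->
    cn (rect G u.1 (u.1 + (b - a) / 2) u.2 (u.2 + (d - c) / 2)) <= e / 4.
  move=> h1 h2; rewrite leNgt; apply/negP => h3; apply: hn; exists u; split => //.
have s1 := small (a, c) ltac:(by left) ltac:(by left).
have s2 := small (a, n) ltac:(by left) ltac:(by right).
have s3 := small (m, c) ltac:(by right) ltac:(by left).
have s4 := small (m, n) ltac:(by right) ltac:(by right).
move: s1 s2 s3 s4; rewrite /= e1 e2 e3 e4 => s1 s2 s3 s4.
move: he; apply/negP; rewrite -leNgt.
apply: (le_trans (cnD _ _)); apply: (@le_trans _ _ ((e / 4 + e / 4) + (e / 4 + e / 4))).
  by apply: lerD; apply: (le_trans (cnD _ _)); apply: lerD.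
lra.
Qed.

Lemma nested_point (a : nat -> R) (l : nat -> R) :
  (forall n, a n <= a n.+1) -> (forall n, a n.+1 + l n.+1 <= a n + l n) ->
  (forall n, 0 <= l n) ->
  exists x, forall n, a n <= x <= a n + l n.
Proof.
move=> a_up al_dn l0.
have mono : {homo a : n m / (n <= m)%N >-> n <= m}.
  by apply: homo_leq => //; [exact: le_trans].
have anti n k : a (n + k)%N + l (n + k)%N <= a n + l n.
  elim: k => [|k IH]; first by rewrite addn0.
  by rewrite addnS (le_trans (al_dn _)).
have am n k : a k <= a n + l n.
  have [nk|kn] := leqP n k.
    rewrite -(subnKC nk) (le_trans _ (anti n (k - n)%N)) // lerDl //.
  by rewrite (le_trans (mono _ _ (ltnW kn))) // lerDl.
have ubn n : ubound (range a) (a n + l n) by move=> _ [k _ <-].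
exists (sup (range a)) => n; apply/andP; split.
  apply: ub_le_sup; last by exists n.
  by exists (a 0%N + l 0%N); exact: ubn.
by apply: ge_sup; [exists (a 0%N); exists 0%N | exact: ubn].
Qed.

Lemma goursat G a b c d : a < b -> c < d ->
  (forall z, in_rect a b c d z -> exists k, cdiff G z k) -> rect G a b c d = 0.
Proof.
move=> ab cd H; apply: contrapT => /eqP; rewrite -cn_gt0.
set K := cn _ => K0.
have Hc z : in_rect a b c d z -> ccont G z by move=> /H [k /cdiff_ccont].
pose p := b - a; pose q := d - c; pose l n : R := (2 ^+ n)^-1.
have p0 : 0 < p by rewrite subr_gt0.
have q0 : 0 < q by rewrite subr_gt0.
have l_gt0 n : 0 < l n by rewrite invr_gt0 exprn_gt0.
have lS n : l n.+1 = l n / 2 by rewrite /l exprS invfM mulrC.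
(* Each bisection divides the bound by 4, that is, multiplies it like [l n ^+ 2]; starting from
   [K / 2] makes the inequality strict at the first rectangle. *)
pose good n (u : R * R) := [/\ a <= u.1, u.1 + p * l n <= b, c <= u.2, u.2 + q * l n <= d &
  K / 2 * l n ^+ 2 < cn (rect G u.1 (u.1 + p * l n) u.2 (u.2 + q * l n))].
(* The implication stands under the existential so that [choice] yields a function on all pairs,
   good or not. *)
have step n (u : R * R) : exists v : R * R, good n u ->
    [/\ good n.+1 v, u.1 <= v.1, v.1 + p * l n.+1 <= u.1 + p * l n,
     u.2 <= v.2 & v.2 + q * l n.+1 <= u.2 + q * l n].
  have [[h1 h2 h3 h4 h5]|ng] := pselect (good n u); last by exists u => /ng.
  have pl : 0 < p * l n by rewrite mulr_gt0.
  have ql : 0 < q * l n by rewrite mulr_gt0.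
  have Kl : 0 <= K / 2 * l n ^+ 2 by rewrite mulr_ge0 ?divr_ge0 ?exprn_ge0 // ltW.
  have [||z hz|v [v1 v2 hv]] := goursat_step Kl _ _ _ h5.
  - by rewrite lerDl ltW.
  - by rewrite lerDl ltW.
  - by apply: Hc; apply: in_rect_sub hz.
  have pS : p * l n.+1 = p * l n / 2 by rewrite lS mulrA.
  have qS : q * l n.+1 = q * l n / 2 by rewrite lS mulrA.
  exists v => _.
  have [i1 i2] : u.1 <= v.1 /\ v.1 + p * l n.+1 <= u.1 + p * l n.
    rewrite pS; move: pl v1; move: (p * l n) => pl pl0.
    by move=> [->|->]; split; lra.
  have [i3 i4] : u.2 <= v.2 /\ v.2 + q * l n.+1 <= u.2 + q * l n.
    rewrite qS; move: ql v2; move: (q * l n) => ql ql0.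
    by move=> [->|->]; split; lra.
  split => //; split.
  - exact: le_trans i1.
  - exact: le_trans h2.
  - exact: le_trans i3.
  - exact: le_trans h4.
  - move: hv; rewrite !(addrC u.1) !(addrC u.2) !addrK pS qS.
    suff -> : K / 2 * l n.+1 ^+ 2 = K / 2 * l n ^+ 2 / 4 by [].
    by rewrite lS; field.
have [f Hf] := choice (fun nu : nat * (R * R) => step nu.1 nu.2).
pose u := fix u n := if n is n'.+1 then f (n', u n') else (a, c).
have gu n : good n (u n).
  elim: n => [|n IH]; last by have [] := Hf (n, u n) IH.
  rewrite /good /l /= expr0 invr1 !mulr1 /p /q !(addrC a) !(addrC c) !subrK expr1n mulr1.
  by split=> //; rewrite -/K ltr_pdivrMr // ltr_pMr // ltr1n.
have uS n := Hf (n, u n) (gu n).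
have [||n|x Hx] := @nested_point (fun n => (u n).1) (fun n => p * l n).
- by move=> n; have [] := uS n.
- by move=> n; have [] := uS n.
- by rewrite mulr_ge0 // ltW.
have [||n|y Hy] := @nested_point (fun n => (u n).2) (fun n => q * l n).
- by move=> n; have [] := uS n.
- by move=> n; have [] := uS n.
- by rewrite mulr_ge0 // ltW.
have inn n : in_rect (u n).1 ((u n).1 + p * l n) (u n).2 ((u n).2 + q * l n) (x +i* y).
  by rewrite /in_rect /= Hx Hy.
have [k [S [cS _ HS]]] : exists k, cdiff G (x +i* y) k.
  by apply: H; have [h1 h2 h3 h4 _] := gu 0%N; apply: in_rect_sub (inn 0%N).
(* Chosen so that [4 * (eta * ((p + q) * l n)) * ((p + q) * l n)] equals [K / 2 * l n ^+ 2], the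
   lower bound kept in [good]. *)
pose eta := K / (8 * (p + q) ^+ 2).
have pq0 : 0 < p + q by rewrite addr_gt0.
have eta0 : 0 < eta by rewrite divr_gt0 // mulr_gt0 // exprn_gt0.
have [dl dl0 Hdl] := cS _ eta0.
have [n Hn] : exists n, (p + q) * l n < dl.
  have := @near_infty_natSinv_expn_lt R (PosNum (divr_gt0 dl0 pq0)).
  move=> [n _ /(_ n (leqnn _))] /=; rewrite ltr_pdivlMr // => h; exists n.
  by rewrite mulrC /l -div1r.
have [h1 h2 h3 h4] := gu n; apply/negP; rewrite -leNgt.
have pl : 0 <= p * l n by rewrite mulr_ge0 // ltW.
have ql : 0 <= q * l n by rewrite mulr_ge0 // ltW.
have := @cn_rect_affine G (u n).1 ((u n).1 + p * l n) (u n).2 ((u n).2 + q * l n)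
  (x +i* y) (G (x +i* y)) (S (x +i* y)) (eta * ((p + q) * l n)).
rewrite !lerDl => /(_ pl ql).
have sub z : in_rect (u n).1 ((u n).1 + p * l n) (u n).2 ((u n).2 + q * l n) z -> in_rect a b c d z.
  by apply: in_rect_sub.
move=> /(_ (fun z hz => Hc z (sub z hz))); rewrite !(addrC (u n).1) !(addrC (u n).2) !addrK.
move=> h; apply: (le_trans (h _)); last first.
  rewrite -mulrDl /eta le_eqVlt; apply/orP; left; apply/eqP.
  by field; rewrite lt0r_neq0.
move=> z hz; have zle : cn (z - (x +i* y)) <= (p + q) * l n.
  have := cn_in_rect_le _ (inn n); rewrite !(addrC (u n).1) !(addrC (u n).2) !addrK -mulrDl.
  by apply.
have -> : G z - (G (x +i* y) + S (x +i* y) * (z - (x +i* y))) =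
    (S z - S (x +i* y)) * (z - (x +i* y)).
  by rewrite opprD addrA HS mulrBl.
rewrite cnM ler_pM ?cn_ge0 //; apply: ltW; apply: Hdl.
exact: le_lt_trans zle Hn.
Qed.

Lemma cint_pt (F : R -> R[i]) a : cint F a a = 0.
Proof. by rewrite /cint /rint !set_itv1 !Rintegral_set1. Qed.

Lemma rect_degx G a c d : c <= d -> rect G a a c d = 0.
Proof.
move=> cd; rewrite /rect cint_pt add0r (@eq_cint _ _ _ _ (fun=> 0)).
  by rewrite cint_cst // mul0r mulr0.
by move=> t _; rewrite subrr.
Qed.

Lemma rect_degy G a b c : a <= b -> rect G a b c c = 0.
Proof.
move=> ab; rewrite /rect cint_pt mulr0 addr0 (@eq_cint _ _ _ _ (fun=> 0)).
  by rewrite cint_cst // mul0r.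
by move=> t _; rewrite subrr.
Qed.

End Goursat.

(** * The maximum modulus principle *)

Section MaximumModulus.
Variable R : realType.
Implicit Types (G h : R[i] -> R[i]) (z w s : R[i]) (a b c d m x y r M : R).

(** Cutting off rectangles that miss [z0] leaves an arbitrarily small one around it. There [G] is
    nearly constant by continuity, so the integral is at most a multiple of the perimeter. *)
Lemma rect_shrink G a b c d z0 : a <= b -> c <= d ->
  (forall z, in_rect a b c d z -> ccont G z) -> in_rect a b c d z0 ->
  (forall a' b' c' d', a <= a' -> a' <= b' -> b' <= b -> c <= c' -> c' <= d' -> d' <= d ->
    ~~ in_rect a' b' c' d' z0 -> rect G a' b' c' d' = 0) ->
  rect G a b c d = 0.
Proof.
move=> ab cd H z0in Hsub; have /andP[/andP[h1 h2] /andP[h3 h4]] := z0in.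
apply: contrapT => /eqP; rewrite -cn_gt0; set K := cn _ => K0.
have [dl dl0 Hdl] := H _ z0in 1 ltr01.
(* The remaining sides have length at most [2 * e]: the first bound keeps the rectangle within [dl]
   of [z0], the second makes [4 * (2 * e + 2 * e)] smaller than [K]. *)
pose e := Num.min (dl / 8) (K / 32).
have e0 : 0 < e by rewrite lt_min !divr_gt0.
have edl : e <= dl / 8 by rewrite ge_min lexx.
have eK : e <= K / 32 by rewrite ge_min lexx orbT.
set x0 := complex.Re z0 in h1 h2; set y0 := complex.Im z0 in h3 h4.
(* When [z0] is close to a side, the small interval is clipped there and the strip to be cut off
   degenerates. *)
have cut l u v : l <= u -> u <= v -> exists mm : R * R,
  [/\ l <= mm.1 /\ mm.1 <= mm.2, mm.2 <= v, u - e <= mm.1, mm.2 <= u + e &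
    (mm.1 = l \/ mm.1 < u) /\ (mm.2 = v \/ u < mm.2)].
  clear -e0 => lu uv; exists (Num.max l (u - e), Num.min v (u + e)).
  rewrite /Num.max /Num.min /=; case: ltP => hl; case: ltP => hv;
    split; try (split; [(by left)||right|(by left)||right]); try (split; lra); lra.
have [[m1 m2] /= [[am1 m12] m2b xm1 m2x [m1x xm2]]] := cut _ _ _ h1 h2.
have [[n1 n2] /= [[cn1 n12] n2d yn1 n2y [n1y yn2]]] := cut _ _ _ h3 h4.
have m1b := le_trans m12 m2b; have n1d := le_trans n12 n2d.
have z1 : rect G a m1 c d = 0.
  case: m1x => [->|m1x]; first exact: rect_degx.
  by apply: Hsub => //; rewrite /in_rect -/x0 [x0 <= m1]leNgt m1x andbF.
have z2 : rect G m2 b c d = 0.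
  case: xm2 => [->|xm2]; first exact: rect_degx.
  by apply: Hsub => //; rewrite ?(le_trans am1) // /in_rect -/x0 [m2 <= x0]leNgt xm2.
have z3 : rect G m1 m2 c n1 = 0.
  case: n1y => [->|n1y]; first exact: rect_degy.
  by apply: Hsub => //; rewrite /in_rect -/y0 [y0 <= n1]leNgt n1y !andbF.
have z4 : rect G m1 m2 n2 d = 0.
  case: yn2 => [->|yn2]; first exact: rect_degy.
  by apply: Hsub => //; rewrite ?(le_trans cn1) // /in_rect -/y0 [n2 <= y0]leNgt yn2 andbF.
have H1 z : in_rect m1 b c d z -> ccont G z by move=> /(in_rect_sub am1 (lexx _) (lexx _) (lexx _))/H.
have H2 z : in_rect m1 m2 c d z -> ccont G z by move=> /(in_rect_sub am1 m2b (lexx _) (lexx _))/H.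
have H3 z : in_rect m1 m2 n1 d z -> ccont G z by move=> /(in_rect_sub am1 m2b cn1 (lexx _))/H.
have H4 z : in_rect m1 m2 n1 n2 z -> ccont G z by move=> /(in_rect_sub am1 m2b cn1 n2d)/H.
have E : rect G a b c d = rect G m1 m2 n1 n2.
  rewrite (rect_splitx am1 m1b cd H) z1 add0r (rect_splitx m12 m2b cd H1) z2 addr0.
  by rewrite (rect_splity m12 cn1 n1d H2) z3 add0r (rect_splity m12 n12 n2d H3) z4 addr0.
have : K <= 4 * 1 * ((m2 - m1) + (n2 - n1)).
  rewrite /K E; apply: (@cn_rect_affine _ _ _ _ _ _ z0 (G z0) 0) => // z /andP[/andP[k1 k2] /andP[k3 k4]].
  rewrite mul0r addr0; apply/ltW/Hdl; apply: (le_lt_trans (cn_le_ReIm _)).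
  rewrite ReB ImB -/x0 -/y0.
  have hx : `|complex.Re z - x0| <= e by clear -k1 k2 xm1 m2x; rewrite ler_norml; apply/andP; split; lra.
  have hy : `|complex.Im z - y0| <= e by clear -k3 k4 yn1 n2y; rewrite ler_norml; apply/andP; split; lra.
  by apply: (le_lt_trans (lerD hx hy)); clear -edl dl0; lra.
by apply/negP; rewrite -ltNge; clear -eK K0 xm1 m2x yn1 n2y; lra.
Qed.

(** Exceptional points are allowed because a [slope] is only known to be continuous at its base
    point. *)
Lemma goursat_except G (Z : seq R[i]) a b c d : a <= b -> c <= d ->
  (forall z, in_rect a b c d z -> ccont G z) ->
  (forall z, in_rect a b c d z -> z \notin Z -> exists l, cdiff G z l) ->
  rect G a b c d = 0.
Proof.
elim: Z a b c d => [|z0 Z IH] a b c d ab cd Hc Hd.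
  move: ab; rewrite le_eqVlt => /predU1P[->|ab]; first exact: rect_degx.
  move: cd; rewrite le_eqVlt => /predU1P[->|cd]; first by apply: rect_degy; exact: ltW.
  by apply: goursat => // z /Hd; apply.
have IH' a' b' c' d' : a <= a' -> a' <= b' -> b' <= b -> c <= c' -> c' <= d' -> d' <= d ->
    ~~ in_rect a' b' c' d' z0 -> rect G a' b' c' d' = 0.
  move=> aa ab' bb cc cd' dd z0n; apply: IH => // z zin.
    exact: Hc (in_rect_sub aa bb cc dd zin).
  move=> zZ; apply: Hd; first exact: (in_rect_sub aa bb cc dd zin).
  by rewrite inE negb_or zZ andbT; apply: contraNneq z0n => <-.
have [z0in|z0n] := boolP (in_rect a b c d z0); last by apply: IH'.
exact: rect_shrink z0in IH'.
Qed.

Definition on_border a b c d z := in_rect a b c d z &&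
  [|| complex.Re z == a, complex.Re z == b, complex.Im z == c | complex.Im z == d].

Lemma ReV z : complex.Re z^-1 = complex.Re z / cn z ^+ 2.
Proof. by rewrite sqr_cn; case: z. Qed.
Lemma ImV z : complex.Im z^-1 = - complex.Im z / cn z ^+ 2.
Proof. by rewrite sqr_cn mulNr; case: z. Qed.

Lemma ccont_slope_neq h s l w : w != s -> ccont h w -> ccont (slope h s l) w.
Proof.
move=> wp ch; apply: (@ccont_ext _ (fun w => (h w - h s) / (w - s)) _ _ (cn (w - s))).
- by rewrite cn_gt0 subr_eq0.
- move=> v; rewrite /slope; case: eqVneq => // ->.
  by rewrite cn_distC ltxx.
- apply: ccontM; first by apply: ccontB => //; exact: ccont_cst.
  apply: ccontV; last by rewrite subr_eq0.
  by apply: ccontB; [exact: ccont_id | exact: ccont_cst].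
Qed.

Lemma ccontX h z n : ccont h z -> ccont (fun w => h w ^+ n) z.
Proof.
move=> ch; elim: n => [|n IH].
  by under eq_fun do rewrite expr0; exact: ccont_cst.
by under eq_fun do rewrite exprS; apply: ccontM.
Qed.

Lemma exp_lt_eps (rho e : R) : 0 <= rho < 1 -> 0 < e -> exists n, rho ^+ n < e.
Proof.
move=> /andP[r0 r1] e0.
have /cvgrPdist_lt := @cvg_expr R rho ltac:(by rewrite ger0_norm).
move=> /(_ e e0) [n _ /(_ n (leqnn n))] /=.
by rewrite sub0r normrN ger0_norm ?exprn_ge0 // => h; exists n.
Qed.

(* Landau's power trick: Cauchy's formula for [(k / k s) ^ N] bounds it at [s] by a
   constant independent of [N] times its maximum on the border. *)
Lemma max_modulus (k : R[i] -> R[i]) (Z : seq R[i]) a b c d M s : 0 <= M ->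
  (forall z, in_rect a b c d z -> ccont k z) ->
  (forall z, in_rect a b c d z -> z \notin Z -> exists l, cdiff k z l) ->
  a < complex.Re s < b -> c < complex.Im s < d -> s \notin Z ->
  (forall z, on_border a b c d z -> cn (k z) <= M) -> cn (k s) <= M.
Proof.
move=> M0 Hc Hd /andP[h1 h2] /andP[h3 h4] sZ HM; rewrite leNgt; apply/negP => Mks.
have ks0 : 0 < cn (k s) := le_lt_trans M0 Mks.
have ksn : k s != 0 by rewrite -cn_gt0.
pose h w := k w / k s; pose rho := M / cn (k s).
have rho01 : 0 <= rho < 1 by rewrite divr_ge0 ?(ltW ks0) // ltr_pdivrMr // mul1r Mks.
have sin : in_rect a b c d s by rewrite /in_rect !(ltW h1, ltW h2, ltW h3, ltW h4).
have hc z : in_rect a b c d z -> ccont h z.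
  by move=> /Hc ck; apply: ccontM ck _; exact: ccont_cst.
have hd z : in_rect a b c d z -> z \notin Z -> exists l, cdiff h z l.
  move=> zi /(Hd z zi) [k' dk]; eexists; apply: cdiffM dk _; exact: cdiff_cst.
set x := complex.Re s in h1 h2; set y := complex.Im s in h3 h4.
pose dl := Num.min (Num.min (x - a) (b - x)) (Num.min (y - c) (d - y)).
have dl0 : 0 < dl by rewrite !lt_min !subr_gt0 h1 h2 h3 h4.
have [dl1 dl2 dl3 dl4] : [/\ dl <= x - a, dl <= b - x, dl <= y - c & dl <= d - y].
  by rewrite !ge_min !lexx !orbT.
pose D := (b - a) + (d - c).
have D0 : 0 < D by rewrite /D; lra.
(* On each side of the border, the component of [(z - s)^-1] normal to that side is a distance of at
   least [dl] divided by [cn (z - s) ^+ 2 <= D ^+ 2], so its size is at least [e]. *)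
pose e := dl / D ^+ 2.
have e0 : 0 < e by rewrite divr_gt0 // exprn_gt0.
have [N HN] := exp_lt_eps rho01 (mulr_gt0 dl0 (divr_gt0 e0 (ltr0Sn _ 1))).
have [k1 dk1] := hd s sin sZ.
have [kN dkN] := cdiffX N dk1.
have hs : h s = 1 by rewrite /h divff.
(* The contour integral of [G] vanishes, but on the border [G] is within [e / 2] of [- (z - s)^-1],
   all of whose contributions to the imaginary part of the integral have the same sign. This sign
   replaces the exact value of the integral of [(z - s)^-1]. *)
pose G := slope (fun w => h w ^+ N) s kN.
have G0 : rect G a b c d = 0.
  apply: (@goursat_except _ (s :: Z)); rewrite ?(ltW (lt_trans h1 h2), ltW (lt_trans h3 h4)) //.
    move=> z zi; case: (eqVneq z s) => [->|zs]; first exact: ccont_slope.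
    by apply: ccont_slope_neq => //; apply/ccontX/hc.
  move=> z zi; rewrite inE negb_or => /andP[zs zZ].
  have [k' dk'] := hd z zi zZ; have [k'' dk''] := cdiffX N dk'.
  exact: cdiff_slope dk''.
have Gc z : in_rect a b c d z -> ccont G z.
  move=> zi; case: (eqVneq z s) => [->|zs]; first exact: ccont_slope.
  by apply: ccont_slope_neq => //; apply/ccontX/hc.
have border z : on_border a b c d z -> dl <= cn (z - s) /\ cn (z - s) <= D.
  move=> /andP[zi zb]; split; last exact: cn_in_rect_le.
  case/or4P: zb => /eqP zb; [apply: (le_trans _ (ler_Re_cn _))|apply: (le_trans _ (ler_Re_cn _))
    |apply: (le_trans _ (ler_Im_cn _))|apply: (le_trans _ (ler_Im_cn _))];
    rewrite ?ReB ?ImB zb -/x -/y ler_normr; apply/orP; rewrite ?opprB; [right|left|right|left]; lra.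
have near z : on_border a b c d z -> cn (G z + (z - s)^-1) < e / 2.
  move=> zb; have [z1 z2] := border z zb.
  have z0 : 0 < cn (z - s) := lt_le_trans dl0 z1.
  have zs : z != s by rewrite -subr_eq0 -cn_gt0.
  rewrite /G /slope (negPf zs) hs expr1n mulrBl mul1r subrK cnM cnX cnV /h cnM cnV.
  rewrite ltr_pdivrMr //; apply: (@lt_le_trans _ _ (dl * (e / 2))).
    apply: le_lt_trans HN; rewrite lerXn2r ?nnegrE ?divr_ge0 ?cn_ge0 //.
    by rewrite ler_pM2r ?invr_gt0 // HM.
  by rewrite mulrC ler_wpM2l // divr_ge0 // ltW.
have quot (u : R) z : on_border a b c d z -> dl <= u -> e <= u / cn (z - s) ^+ 2.
  move=> /border [z1 z2] ul; have z0 : 0 < cn (z - s) := lt_le_trans dl0 z1.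
  rewrite ler_pM ?(ltW dl0) //; first by rewrite invr_ge0 exprn_ge0 // ltW.
  by rewrite lef_pV2 ?posrE ?exprn_gt0 // lerXn2r // nnegrE ltW.
have ab : a < b := lt_trans h1 h2; have cd : c < d := lt_trans h3 h4.
have nearIm z : on_border a b c d z ->
    `|complex.Im (G z) - complex.Im (z - s) / cn (z - s) ^+ 2| < e / 2.
  by move=> /near; move/(le_lt_trans (ler_Im_cn _)); rewrite (ImD (G z)) ImV mulNr.
have nearRe z : on_border a b c d z ->
    `|complex.Re (G z) + complex.Re (z - s) / cn (z - s) ^+ 2| < e / 2.
  by move=> /near; move/(le_lt_trans (ler_Re_cn _)); rewrite (ReD (G z)) ReV.
have G1 : complex.Im (rect G a b c d) =
    rint (fun t => complex.Im (G (t +i* c) - G (t +i* d))) a b +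
    rint (fun t => complex.Re (G (b +i* t) - G (a +i* t))) c d.
  by rewrite /rect ImD ImM /= mul0r mul1r add0r.
have aa : a <= a <= b by rewrite lexx ltW.
have bb : a <= b <= b by rewrite lexx ltW.
have cc : c <= c <= d by rewrite lexx ltW.
have dd : c <= d <= d by rewrite lexx ltW.
have ch : pcont_on a b (fun t => G (t +i* c) - G (t +i* d)).
  by apply: pcont_onB; apply: (pcont_on_h Gc).
have cv : pcont_on c d (fun t => G (b +i* t) - G (a +i* t)).
  by apply: pcont_onB; apply: (pcont_on_v Gc).
have bot t : a <= t <= b -> complex.Im (G (t +i* c)) <= - (e / 2).
  move=> tb; have zb : on_border a b c d (t +i* c) by rewrite /on_border /in_rect /= tb cc eqxx !orbT.
  have := quot (y - c) _ zb dl3; have := nearIm _ zb; rewrite ImB /= -/y -[c - y]opprB mulNr.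
  by rewrite ltr_norml => /andP[]; lra.
have top t : a <= t <= b -> e / 2 <= complex.Im (G (t +i* d)).
  move=> tb; have zb : on_border a b c d (t +i* d) by rewrite /on_border /in_rect /= tb dd eqxx !orbT.
  have := quot (d - y) _ zb dl4; have := nearIm _ zb; rewrite ImB /= -/y.
  by rewrite ltr_norml => /andP[]; lra.
have right t : c <= t <= d -> complex.Re (G (b +i* t)) <= - (e / 2).
  move=> tb; have zb : on_border a b c d (b +i* t) by rewrite /on_border /in_rect /= tb bb eqxx !orbT.
  have := quot (b - x) _ zb dl2; have := nearRe _ zb; rewrite ReB /= -/x.
  by rewrite ltr_norml => /andP[]; lra.
have left t : c <= t <= d -> e / 2 <= complex.Re (G (a +i* t)).
  move=> tb; have zb : on_border a b c d (a +i* t) by rewrite /on_border /in_rect /= tb aa eqxx.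
  have := quot (x - a) _ zb dl1; have := nearRe _ zb; rewrite ReB /= -/x -[a - x]opprB mulNr.
  by rewrite ltr_norml => /andP[]; lra.
have I1 : rint (fun t => complex.Im (G (t +i* c) - G (t +i* d))) a b <= - e * (b - a).
  apply: rint_le (ltW ab) (pcont_on_Im ch) _ => t tb.
  by have := bot t tb; have := top t tb; rewrite ImB; lra.
have I2 : rint (fun t => complex.Re (G (b +i* t) - G (a +i* t))) c d <= - e * (d - c).
  apply: rint_le (ltW cd) (pcont_on_Re cv) _ => t tb.
  by have := right t tb; have := left t tb; rewrite ReB; lra.
have := lerD I1 I2; rewrite -G1 G0 /= -mulrDr -/D mulNr oppr_ge0.
by apply/negP; rewrite -ltNge mulr_gt0.
Qed.
End MaximumModulus.

(** * Schwarz, Schwarz-Pick and Harnack estimates *)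

Section SchwarzEstimates.
Variable R : realType.
Implicit Types (h : R[i] -> R[i]) (z w s : R[i]) (r M : R).

(** The maximum principle applies to the slope of [h] at [s] on the square of half side [r / 3]. The
    square lies in the disc since [r / 3 + r / 3 < r], and on its border the divisor is at least
    [r / 3], whence [3 * M / r]. *)
Lemma schwarz_square h s r M : 0 < r ->
  (forall z, cn (z - s) < r -> exists l, cdiff h z l) ->
  (forall z, cn (z - s) < r -> cn (h z - h s) <= M) ->
  forall z, cn (z - s) < r / 3 -> cn (h z - h s) <= 3 * M / r * cn (z - s).
Proof.
move=> r0 hd hM z zr; have [->|zs] := eqVneq z s.
  by rewrite !subrr cn0 mulr0.
have [|l dl] := hd s; first by rewrite subrr cn0.
have M0 : 0 <= M by apply: (le_trans (cn_ge0 _) (hM s _)); rewrite subrr cn0.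
rewrite (slopeE h s l z) cnM ler_wpM2r ?cn_ge0 //.
set x := complex.Re s; set y := complex.Im s.
have ins w : in_rect (x - r / 3) (x + r / 3) (y - r / 3) (y + r / 3) w -> cn (w - s) < r.
  move=> /andP[/andP[k1 k2] /andP[k3 k4]]; apply: (le_lt_trans (cn_le_ReIm _)).
  rewrite ReB ImB -/x -/y.
  have hx : `|complex.Re w - x| <= r / 3 by clear -k1 k2; rewrite ler_norml; apply/andP; split; lra.
  have hy : `|complex.Im w - y| <= r / 3 by clear -k3 k4; rewrite ler_norml; apply/andP; split; lra.
  by apply: (le_lt_trans (lerD hx hy)); clear -r0; lra.
have hx : `|complex.Re z - x| < r / 3 by rewrite -ReB (le_lt_trans (ler_Re_cn _)).
have hy : `|complex.Im z - y| < r / 3 by rewrite -ImB (le_lt_trans (ler_Im_cn _)).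
apply: (@max_modulus _ _ [:: s] (x - r / 3) (x + r / 3) (y - r / 3) (y + r / 3)).
- by rewrite divr_ge0 ?mulr_ge0 // ltW.
- move=> w /ins /hd [l' dl']; have [->|ws] := eqVneq w s; first exact: ccont_slope.
  exact: ccont_slope_neq ws (cdiff_ccont dl').
- move=> w /ins /hd [l' dl']; rewrite inE => ws; exact: cdiff_slope ws dl'.
- by clear -hx; move: hx; rewrite ltr_norml => /andP[h1 h2]; apply/andP; split; lra.
- by clear -hy; move: hy; rewrite ltr_norml => /andP[h1 h2]; apply/andP; split; lra.
- by rewrite inE.
- move=> w /andP[wi wb]; have wr : r / 3 <= cn (w - s).
    case/or4P: wb => /eqP wb; [apply: (le_trans _ (ler_Re_cn _))|apply: (le_trans _ (ler_Re_cn _))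
    |apply: (le_trans _ (ler_Im_cn _))|apply: (le_trans _ (ler_Im_cn _))];
    rewrite ?ReB ?ImB wb -/x -/y ler_normr; apply/orP; [right|left|right|left]; clear; lra.
  have w0 : 0 < cn (w - s) by apply: lt_le_trans wr; rewrite divr_gt0.
  have ws : w != s by rewrite -subr_eq0 -cn_gt0.
  rewrite /slope (negPf ws) cnM cnV ler_pdivrMr // (le_trans (hM w (ins w wi))) //.
  have -> : 3 * M / r = M / (r / 3) by field; exact: lt0r_neq0.
  by rewrite mulrAC ler_pdivlMr ?divr_gt0 // ler_wpM2l.
Qed.

(* With [v := s / N], the increments of [h] along [0, v, 2 v, .., N v = s] differ
   from [h v - h 0] by second differences, which two uses of the Schwarz estimate
   bound. *)
Lemma taylor2 h s l r M : 0 < r ->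
  (forall z, cn z < r -> exists k, cdiff h z k) ->
  (forall z, cn z < r -> cn (h z) <= M) ->
  cdiff h 0 l -> cn s < r / 6 ->
  cn (h s - h 0 - l * s) <= 144 * M / r ^+ 2 * cn s ^+ 2.
Proof.
move=> r0 hd hM dl sr.
have M0 : 0 <= M by apply: (le_trans (cn_ge0 _) (hM 0 _)); rewrite cn0.
have r2 : 0 < r / 2 by rewrite divr_gt0.
(* The disc of radius [r / 2] about [z] stays in the domain and [h] varies there by at most [2 * M],
   so the constant is [3 * (2 * M) / (r / 2)]. *)
have lip v z : cn v < r / 6 -> cn z < r / 2 -> cn (h (z + v) - h z) <= 12 * M / r * cn v.
  move=> vr zr; have := @schwarz_square h z (r / 2) (2 * M) r2.
  have zw w : cn (w - z) < r / 2 -> cn w < r.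
    move=> wz; rewrite -[w](subrK z) (le_lt_trans (cnD _ _)) //.
    by rewrite [r]splitr ltrD.
  move=> /(_ (fun w hw => hd w (zw w hw))) H.
  have {H} := H _ (z + v); rewrite addrC addKr.
  have -> : 3 * (2 * M) / (r / 2) = 12 * M / r by field; exact: lt0r_neq0.
  apply.
    move=> w /zw wr; apply: (le_trans (cnB _ _)); rewrite mulr2n mulrDl mul1r.
    by rewrite lerD // hM // (lt_trans zr) //; lra.
  by apply: lt_le_trans vr _; lra.
have lip2 v z : cn v < r / 6 -> cn z < r / 6 ->
    cn (h (z + v) - h z - (h v - h 0)) <= 144 * M / r ^+ 2 * (cn v * cn z).
  move=> vr zr; pose D w := h (w + v) - h w.
  have := @schwarz_square D 0 (r / 2) (24 * M / r * cn v) r2.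
  have zw w : cn (w - 0) < r / 2 -> cn w < r /\ cn (w + v) < r.
    rewrite subr0 => wr; split; first by lra.
    by rewrite (le_lt_trans (cnD _ _)) //; lra.
  move=> H; have {H} := H _ _ z; rewrite !subr0 /D add0r.
  have -> : 3 * (24 * M / r * cn v) / (r / 2) = 144 * M / r ^+ 2 * cn v.
    by field; exact: lt0r_neq0.
  rewrite (mulrA _ (cn v)); apply.
  - move=> w /zw [w1 w2]; have [k1 d1] := hd _ w1; have [k2 d2] := hd _ w2.
    eexists; apply: cdiffB; last exact: d1.
    apply: (@cdiff_comp _ (fun w => w + v) h w _ _ _ d2).
    by apply: cdiffD; [exact: cdiff_id | exact: cdiff_cst].
  - move=> w; rewrite subr0 => wr; apply: (le_trans (cnB _ _)).
    have -> : 24 * M / r * cn v = 12 * M / r * cn v + 12 * M / r * cn v by ring.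
    apply: lerD; first exact: lip.
    by rewrite -[v in h v](add0r v) lip // cn0.
  - by apply: lt_le_trans zr _; lra.
have tele N : (0 < N)%N ->
    cn (h s - h 0 - N%:R * (h (s / N%:R) - h 0)) <= 144 * M / r ^+ 2 * cn s ^+ 2.
  move=> N0; set v := s / N%:R.
  have Nr : (N%:R : R[i]) != 0 by rewrite pnatr_eq0 -lt0n.
  have N0' : (0 : R) < N%:R by rewrite ltr0n.
  have cnN' m : cn (m%:R : R[i]) = m%:R.
    by rewrite -(rmorph_nat (real_complex R)) cn_real ger0_norm.
  have cv : cn v = cn s / N%:R by rewrite /v cnM cnV cnN'.
  have vs m : (m <= N)%N -> cn (m%:R * v) <= cn s.
    move=> mN; rewrite cnM cnN' cv mulrCA ler_piMr ?cn_ge0 //.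
    by rewrite ler_pdivrMr // mul1r ler_nat.
  have ih m : (m <= N)%N ->
      cn (h (m%:R * v) - h 0 - m%:R * (h v - h 0)) <= 144 * M / r ^+ 2 * (m%:R * (cn v * cn s)).
    elim: m => [|m IH] mN; first by rewrite !mul0r subrr subr0 cn0 mulr0.
    rewrite [X in cn X](_ : _ = (h (m%:R * v) - h 0 - m%:R * (h v - h 0)) +
      (h (m%:R * v + v) - h (m%:R * v) - (h v - h 0))); last first.
      rewrite -[m.+1]addn1 natrD !mulrDl !mul1r; ring.
    apply: (le_trans (cnD _ _)).
    have -> : 144 * M / r ^+ 2 * (m.+1%:R * (cn v * cn s)) =
        144 * M / r ^+ 2 * (m%:R * (cn v * cn s)) + 144 * M / r ^+ 2 * (cn v * cn s).
      by rewrite -[m.+1]addn1 natrD; ring.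
    apply: lerD; first exact: IH (ltnW mN).
    have ms := vs m (ltnW mN).
    have v6 : cn v < r / 6.
      by have := vs 1%N N0; rewrite mul1r => /le_lt_trans; apply.
    apply: (le_trans (lip2 _ _ v6 (le_lt_trans ms sr))).
    rewrite ler_wpM2l ?divr_ge0 ?mulr_ge0 ?exprn_ge0 ?(ltW r0) //.
    by rewrite ler_wpM2l ?cn_ge0.
  have := ih N (leqnn _); rewrite cv.
  have -> : N%:R * v = s by rewrite /v mulrCA divff // mulr1.
  suff -> : N%:R * (cn s / N%:R * cn s) = cn s ^+ 2 by [].
  by field; rewrite gt_eqF.
(* As [N] grows, [N * (h (s / N) - h 0)] tends to [l * s], while the bound in [tele] does not depend
   on [N]. *)
apply/ler_addgt0Pr => e e0; move: dl => [S [cS <- HS]].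
have [d d0 Hd] := cS _ (divr_gt0 e0 (ltr_wpDl (cn_ge0 s) ltr01)).
have [N Nd] : exists N, cn s < N.+1%:R * d.
  exists (Num.truncn (cn s / d)); rewrite -ltr_pdivrMr //; exact: truncnS_gt.
have Nr : (N.+1%:R : R[i]) != 0 by rewrite pnatr_eq0.
rewrite [X in cn X](_ : _ = (h s - h 0 - N.+1%:R * (h (s / N.+1%:R) - h 0)) +
  (S (s / N.+1%:R) - S 0) * s); last first.
  rewrite (HS (s / _)) subr0 mulrCA (mulrC _ (s / _)) divfK //; ring.
apply: (le_trans (cnD _ _)); rewrite lerD //; first exact: tele.
rewrite cnM; apply: (@le_trans _ _ (e / (cn s + 1) * cn s)).
  rewrite ler_wpM2r ?cn_ge0 //; apply/ltW/Hd; rewrite subr0 cnM cnV.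
  rewrite -(rmorph_nat (real_complex R)) cn_real ger0_norm // ltr_pdivrMr ?ltr0n //.
  by rewrite mulrC.
rewrite mulrAC ler_pdivrMr ?ltr_wpDl ?cn_ge0 // ler_pM2l //.
by rewrite lerDl.
Qed.

End SchwarzEstimates.

Section SchwarzPick.
Variable R : realType.
Implicit Types (p : R[i] -> R[i]) (z w s t : R[i]) (x y r : R).

(** Compares numerator and denominator of the Cayley quotient [(w - t) / (w - conj t)]: it has
    modulus at most 1 when both imaginary parts are nonnegative. *)
Lemma cn_conj_sq w t :
  cn (w - (complex.Re t +i* - complex.Im t)) ^+ 2 =
  cn (w - t) ^+ 2 + 4 * (complex.Im w * complex.Im t).
Proof. by rewrite !sqr_cn !ReB !ImB /=; ring. Qed.

(** Schwarz's lemma for [k], the quotient of the Cayley transform [u] of [p w] by the Cayley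
    transform of [w]. The half-plane has no compact boundary, so [k] is bounded by
    [Num.sqrt (1 + e)] on the border of a large rectangle that almost touches the real line. *)
Lemma schwarz_pick_strict p z t :
  (forall w, 0 < complex.Im w -> exists l, cdiff p w l) ->
  (forall w, 0 < complex.Im w -> 0 < complex.Im (p w)) ->
  0 < complex.Im z -> 0 < complex.Im t ->
  cn (p z - p t) ^+ 2 * (complex.Im z * complex.Im t) <=
  cn (z - t) ^+ 2 * (complex.Im (p z) * complex.Im (p t)).
Proof.
move=> dp Hp z0 t0; have [->|zt] := eqVneq z t.
  by rewrite !subrr cn0 expr0n /= !mul0r.
set q := p t; set qc := complex.Re q +i* - complex.Im q.
set tc := complex.Re t +i* - complex.Im t.
have q0 : 0 < complex.Im q by exact: Hp.
have den w : 0 < complex.Im w -> p w - qc != 0.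
  move=> w0; rewrite -cn_gt0 (lt_le_trans _ (ler_Im_cn _)) // normr_gt0 gt_eqF //.
  by rewrite ImB /= opprK addr_gt0 // Hp.
pose u w := (p w - q) / (p w - qc).
have ut : u t = 0 by rewrite /u subrr mul0r.
have du w : 0 < complex.Im w -> exists l, cdiff u w l.
  move=> w0; have [l dl] := dp w w0; eexists; apply: cdiffM.
    by apply: cdiffB; [exact: dl | exact: cdiff_cst].
  apply: cdiffV; last exact: den.
  by apply: cdiffB; [exact: dl | exact: cdiff_cst].
have u1 w : 0 < complex.Im w -> cn (u w) <= 1.
  move=> w0; rewrite cnM cnV ler_pdivrMr ?cn_gt0 ?den // mul1r.
  rewrite -(ler_sqr (cn_ge0 _) (cn_ge0 _)) cn_conj_sq lerDl.
  by rewrite !mulr_ge0 // ltW // Hp.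
have [l dl] := du t t0.
pose k w := slope u t l w * (w - tc).
have kE w : w != t -> k w = u w * (w - tc) / (w - t).
  by move=> wt; rewrite /k /slope (negPf wt) ut subr0 mulrAC.
have k1 : cn (k z) ^+ 2 <= 1.
  apply/ler_addgt0Pr => e e0.
  have t2 : 0 < complex.Im t ^+ 2 by rewrite exprn_gt0.
  set y := complex.Im t in t0 t2; set x := complex.Re t.
  (* [L] moves three sides far from [t] and [d] lowers the fourth, so that
     [4 * (Im w * y) <= e * cn (w - t) ^+ 2] on all of them. By [cn_conj_sq] this says [cn (w - tc)
     ^+ 2 <= (1 + e) * cn (w - t) ^+ 2]. *)
  pose L := cn (z - t) + y + 8 * y / e + 1.
  pose d := Num.min (complex.Im z / 2) (Num.min (y / 2) (e * y / 16)).
  have d0 : 0 < d by rewrite !lt_min !divr_gt0 // mulr_gt0.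
  have [dz dy de] : [/\ d <= complex.Im z / 2, d <= y / 2 & d <= e * y / 16].
    by rewrite !ge_min !lexx !orbT.
  have ye : 0 < 8 * y / e by rewrite divr_gt0 // mulr_gt0.
  have zL : cn (z - t) < L by rewrite /L; move: ye t0; lra.
  have yL : y < L by rewrite /L; move: ye t0 (cn_ge0 (z - t)); lra.
  have eL : 8 * y <= e * L.
    rewrite [e * L]mulrC -ler_pdivrMr // /L; move: ye t0 (cn_ge0 (z - t)); lra.
  have sq1 : cn (k z) <= Num.sqrt (1 + e).
    apply: (@max_modulus _ _ [:: t] (x - L) (x + L) d (y + L)).
    - exact: sqrtr_ge0.
    - move=> w /andP[_ /andP[wd _]]; have w0 := lt_le_trans d0 wd.
      have [l' dl'] := du w w0; apply: ccontM; last first.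
        by apply: ccontB; [exact: ccont_id | exact: ccont_cst].
      have [->|wt] := eqVneq w t; first exact: ccont_slope.
      exact: ccont_slope_neq wt (cdiff_ccont dl').
    - move=> w /andP[_ /andP[wd _]]; rewrite inE => wt; have w0 := lt_le_trans d0 wd.
      have [l' dl'] := du w w0; have [l'' dl''] := cdiff_slope l wt dl'.
      eexists; apply: cdiffM; first exact: dl''.
      by apply: cdiffB; [exact: cdiff_id | exact: cdiff_cst].
    - have := le_lt_trans (ler_Re_cn _) zL; rewrite ReB -/x ltr_norml.
      by clear => /andP[h1 h2]; apply/andP; split; lra.
    - have := le_lt_trans (ler_Im_cn _) zL; rewrite ImB -/y ltr_norml.
      by move: dz z0; clear => h3 h4 /andP[h1 h2]; apply/andP; split; lra.
    - by rewrite inE.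
    - move=> w /andP[/andP[_ /andP[wd _]] wb]; have w0 := lt_le_trans d0 wd.
      have main : 4 * (complex.Im w * y) <= e * cn (w - t) ^+ 2.
        have big : L <= cn (w - t) -> 4 * (complex.Im w * y) <= e * cn (w - t) ^+ 2.
          move=> Lw; have := le_trans (ler_norm _) (ler_Im_cn (w - t)); rewrite ImB -/y => wy.
          have w2 : complex.Im w <= 2 * cn (w - t) by move: wy yL Lw; clear; lra.
          apply: (@le_trans _ _ (8 * y * cn (w - t))).
            have := ler_wpM2r (ltW t0) w2; clear; lra.
          apply: (@le_trans _ _ (e * L * cn (w - t))).
            by rewrite ler_wpM2r ?cn_ge0.
          by rewrite expr2 mulrA ler_wpM2r ?cn_ge0 // ler_wpM2l // ltW.
        case/or4P: wb => /eqP wb.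
        - apply: big; apply: (le_trans _ (ler_Re_cn _)); rewrite ReB wb -/x.
          by rewrite addrAC subrr add0r normrN ler_norm.
        - apply: big; apply: (le_trans _ (ler_Re_cn _)); rewrite ReB wb -/x.
          by rewrite addrAC subrr add0r ler_norm.
        - rewrite wb; have h : y / 2 <= cn (w - t).
            apply: (le_trans _ (ler_Im_cn _)); rewrite ImB wb -/y distrC.
            by apply: (le_trans _ (ler_norm _)); move: dy; clear; lra.
          apply: (@le_trans _ _ (e * (y / 2) ^+ 2)).
            by have := ler_wpM2r (ltW t0) de; clear; lra.
          by rewrite ler_wpM2l ?(ltW e0) // lerXn2r ?nnegrE ?cn_ge0 // divr_ge0 ?ltW.
        - apply: big; apply: (le_trans _ (ler_Im_cn _)); rewrite ImB wb -/y.
          by rewrite addrAC subrr add0r ler_norm.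
      have wt0 : 0 < cn (w - t).
        rewrite lt_neqAle cn_ge0 andbT eq_sym; apply/negP => /eqP c0; move: main.
        by rewrite c0 expr0n /= mulr0 leNgt mulr_gt0 // mulr_gt0.
      have wt : w != t by rewrite -subr_eq0 -cn_gt0.
      rewrite kE // cnM cnV ler_pdivrMr //.
      rewrite -(ler_sqr (cn_ge0 _)) ?nnegrE ?mulr_ge0 ?sqrtr_ge0 ?cn_ge0 //.
      rewrite cnM !exprMn sqr_sqrtr ?addr_ge0 // ?(ltW e0) //.
      apply: (@le_trans _ _ (1 * cn (w - tc) ^+ 2)).
        by rewrite ler_wpM2r ?exprn_ge0 ?cn_ge0 // exprn_ile1 ?cn_ge0 // u1.
      by rewrite mul1r cn_conj_sq -/y [(1 + e) * _]mulrDl mul1r lerD2l.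
  rewrite -[1 + e]sqr_sqrtr; last by rewrite addr_ge0 // ltW.
  by rewrite lerXn2r ?nnegrE ?cn_ge0 ?sqrtr_ge0.
have zt0 : 0 < cn (z - t) by rewrite cn_gt0 subr_eq0.
move: k1; rewrite kE // /u !cnM !cnV !exprMn !exprVn -/q.
have pz0 : 0 < cn (p z - qc) ^+ 2 by rewrite exprn_gt0 // cn_gt0 den.
rewrite ler_pdivrMr ?exprn_gt0 // mul1r mulrAC ler_pdivrMr // !cn_conj_sq.
rewrite !mulrDr -/q [cn (z - t) ^+ 2 * cn _ ^+ 2]mulrC lerD2l; lra.
Qed.

(** The Pick functions, real constants included: [diag_partial_const] applies the estimates to
    differences such as [f (a + const_mx s) - s], whose imaginary part may vanish. *)
Definition pick p := (forall w, 0 < complex.Im w -> exists l, cdiff p w l) /\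
  (forall w, 0 < complex.Im w -> 0 <= complex.Im (p w)).

(** Adding [d] times ['i] makes the imaginary part positive. For [d <= 1] the right-hand side grows
    by at most [d * D], which is at most [e]. *)
Lemma schwarz_pick p z t : pick p -> 0 < complex.Im z -> 0 < complex.Im t ->
  cn (p z - p t) ^+ 2 * (complex.Im z * complex.Im t) <=
  cn (z - t) ^+ 2 * (complex.Im (p z) * complex.Im (p t)).
Proof.
move=> [dp Hp] z0 t0; apply/ler_addgt0Pr => e e0.
have a0 := Hp z z0; have b0 := Hp t t0.
set a := complex.Im (p z) in a0 *; set b := complex.Im (p t) in b0 *.
set B := cn (z - t) ^+ 2; have B0 : 0 <= B by rewrite exprn_ge0 ?cn_ge0.
pose D := B * (a + b + 1) + 1.
have D0 : 0 < D by rewrite ltr_wpDl // mulr_ge0 // addr_ge0 ?addr_ge0.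
pose d := Num.min 1 (e / D).
have d0 : 0 < d by rewrite lt_min ltr01 divr_gt0.
have d1 : d <= 1 by rewrite ge_min lexx.
have dD : d * D <= e by rewrite -ler_pdivlMr // ge_min lexx orbT.
have := @schwarz_pick_strict (fun w => p w + (0 +i* d)) z t.
rewrite !ImD /= opprD addrACA subrr addr0 -/a -/b -/B => H; apply: (le_trans (H _ _ z0 t0)).
- move=> w w0; have [l dl] := dp w w0; eexists; apply: cdiffD; [exact: dl | exact: cdiff_cst].
- by move=> w w0; rewrite ImD /= ltr_wpDl // Hp.
- have : B * ((a + d) * (b + d)) <= B * (a * b + d * (a + b + 1)).
    apply: ler_wpM2l => //; have := ler_wpM2l (ltW d0) d1; lra.
  by move: dD d0; rewrite /D; lra.
Qed.

(** With [a] and [b] the imaginary parts at the two heights, Schwarz-Pick with the real parts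
    dropped factors as [(y * a - r * b) * (r * a - y * b) <= 0]. *)
Lemma harnack p x y r : pick p -> 0 < y -> y <= r ->
  y * complex.Im (p (x +i* r)) <= r * complex.Im (p (x +i* y)) /\
  y * complex.Im (p (x +i* y)) <= r * complex.Im (p (x +i* r)).
Proof.
move=> pp y0 yr; have r0 := lt_le_trans y0 yr.
have := @schwarz_pick p (x +i* r) (x +i* y) pp r0 y0.
have a0 := pp.2 (x +i* r) r0; have b0 := pp.2 (x +i* y) y0.
set a := complex.Im (p (x +i* r)) in a0 *; set b := complex.Im (p (x +i* y)) in b0 *.
rewrite !sqr_cn !ReB !ImB /= -/a -/b subrr expr0n /= add0r => H.
have {}H : (a - b) ^+ 2 * (r * y) <= (r - y) ^+ 2 * (a * b).
  have ry : 0 <= r * y by rewrite mulr_ge0 // ltW.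
  by apply: le_trans H; rewrite (ler_wpM2r ry) // lerDr sqr_ge0.
have P : (y * a - r * b) * (r * a - y * b) <= 0.
  by move: H; lra.
have key c1 c2 : 0 <= c1 -> 0 <= c2 ->
    (y * c1 - r * c2) * (r * c1 - y * c2) <= 0 -> y * c1 <= r * c2.
  move=> c10 c20; apply: contraTT; rewrite -!ltNge => h.
  have h' : y * c2 < r * c1.
    apply: (@le_lt_trans _ _ (r * c2)); first by rewrite ler_wpM2r.
    by apply: (lt_le_trans h); rewrite ler_wpM2r.
  by rewrite mulr_gt0 ?subr_gt0.
split; apply: key => //.
by move: P; lra.
Qed.

End SchwarzPick.

(** * Functions on the upper half-space *)

Lemma differentiable_line (K : numFieldType) (V W : normedModType K) (F : V -> W)
    (a v : V) : differentiable F a -> forall e : K, 0 < e ->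
  exists2 d : K, 0 < d & forall h : K, h != 0 -> `|h| < d ->
    `|h^-1 *: (F (h *: v + a) - F a) - 'D_v F a| < e.
Proof.
move=> dF e e0; have /cvgrPdist_lt /(_ e e0) := diff_derivable (v := v) dF.
move=> /nbhs_normP [d /= d0 Hd]; exists d => // h h0 hd.
rewrite distrC; apply: Hd => //=.
by rewrite /ball_ /= sub0r normrN.
Qed.

Section LineDerivative.
Variables (R : realType) (n : nat).
Implicit Types (F : 'rV[R[i]]_n -> R[i]) (a v z : 'rV[R[i]]_n).

Lemma normE (x : R[i]) : `|x| = (cn x)%:C.
Proof. by case: x. Qed.

(** The passage to one variable: the growth and distortion estimates on [f] all come from its
    restrictions to complex lines. *)
Lemma cdiff_line F z v (s : R[i]) : differentiable F (z + s *: v) ->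
  cdiff (fun w => F (z + w *: v)) s ('D_v F (z + s *: v)).
Proof.
move=> dF; exists (slope (fun w => F (z + w *: v)) s ('D_v F (z + s *: v))).
split; [|by rewrite /slope eqxx|exact: slopeE].
move=> e e0; have [|d d0 Hd] := @differentiable_line _ _ _ F _ v dF e%:C.
  by rewrite ltcR.
(* A positive element of [R[i]] is real, so the radius can be read off in [R]. *)
have dR : d = (complex.Re d)%:C by rewrite RRe_real // gtr0_real.
exists (complex.Re d); first by rewrite -ltcR -dR.
move=> w wd; rewrite [slope _ _ _ s]/slope eqxx /slope; case: eqVneq => [_|ws].
  by rewrite subrr cn0.
have h0 : w - s != 0 by rewrite subr_eq0.
have := Hd _ h0; rewrite normE {1}dR ltcR => /(_ wd).
have -> : (w - s) *: v + (z + s *: v) = z + w *: v.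
  by rewrite addrC -addrA -scalerDl (addrC s) subrK.
rewrite normE ltcR; congr (cn (_ - _) < _).
exact: mulrC.
Qed.

Lemma derive_sum F z v : differentiable F z ->
  'D_v F z = \sum_j v ord0 j * 'D_(delta_mx ord0 j) F z.
Proof.
move=> dF; rewrite deriveE // {1}(row_sum_delta v) linear_sum.
by apply: eq_bigr => j _; rewrite linearZ /= deriveE.
Qed.

End LineDerivative.

Lemma differentiable_translate (K : numFieldType) (V W : normedModType K) (F : V -> W)
    (a : V) (c : W) (z : V) : differentiable F (z - a) ->
  differentiable (fun x => F (x - a) + c) z.
Proof.
move=> dF; apply: (@differentiableD _ _ _ (F \o (fun x => x - a)) (cst c)) => //.
apply: differentiable_comp => //.
Qed.

(** * The compact-open topology and uniform approximation on compact sets *)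

Section CompactOpen.
Variables (R : realType) (n : nat).
Notation H := (upper_half_space R n).
Notation rV := 'rV[R[i]]_n.
Implicit Types (F G : rV -> R[i]).

Lemma nbhs_cn (x : R[i]) (e : R) : 0 < e -> nbhs x [set y | cn (y - x) < e].
Proof.
move=> e0; apply/nbhs_normP; exists e%:C; rewrite /= ?ltcR // => y.
by rewrite /ball_ /= normE ltcR cn_distC.
Qed.

Lemma nbhs_box (w : rV) (e : R) : 0 < e ->
  nbhs w [set z : rV | forall j, cn (z ord0 j - w ord0 j) < e].
Proof.
move=> e0; exists (fun _ j => [set y | cn (y - w ord0 j) < e]).
  by move=> i j; rewrite (ord1 i); exact: nbhs_cn.
by move=> z Hz j; exact: Hz.
Qed.

Lemma entourage_cn (E : set (R[i] * R[i])) : entourage E ->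
  exists2 e : R, 0 < e & forall x y, cn (y - x) < e -> E (x, y).
Proof.
rewrite -entourage_ballE => -[d /= d0 Hd].
have dR : d = (complex.Re d)%:C by rewrite RRe_real // gtr0_real.
exists (complex.Re d); first by rewrite -ltcR -dR.
move=> x y xy; apply: Hd; rewrite /= -ball_normE /ball_ /= normE dR ltcR.
by rewrite cn_distC.
Qed.

Lemma holomorphic_continuous F : holomorphic_on H F -> continuous (sigL H F).
Proof.
move=> hF; apply/subspace_sigL_continuousP; apply: continuous_in_subspaceT => z.
by rewrite inE => /hF; exact: differentiable_continuous.
Qed.

(* The filter of uniform convergence on compact sets refines the compact-open one at
   a continuous function. *)
Lemma compact_open_basis (U : set (subspace (holomorphic_space R n))) G :
  open U -> holomorphic_on H G -> U (sigL H G) ->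
  exists K : set H, exists2 d : R, compact K /\ 0 < d &
    forall F, holomorphic_on H F ->
      (forall x, K x -> cn (F (set_val x) - G (set_val x)) < d) -> U (sigL H F).
Proof.
move=> /open_subspaceP [V oV VU] hG UG.
have VG : V (sigL H G).
  suff : (V `&` holomorphic_space R n) (sigL H G) by case.
  by rewrite VU; split => //; exists G.
pose D := [set Kd : set H * R | compact Kd.1 /\ 0 < Kd.2].
pose B (Kd : set H * R) := [set h : H -> R[i] | forall x, Kd.1 x -> cn (h x - sigL H G x) < Kd.2].
have FF : Filter (filter_from D B).
  apply: filter_from_filter.
    by exists (set0, 1); split => //=; exact: compact0.
  move=> [K d] [K' d'] [/= cK d0] [/= cK' d'0].
  exists (K `|` K', Num.min d d').
    by split => /=; [exact: compactU | rewrite lt_min d0].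
  move=> h /= Hh; split=> x Kx; have := Hh x; rewrite lt_min => H0.
    by have /H0/andP[] : (K `|` K') x by left.
  by have /H0/andP[] : (K `|` K') x by right.
have cvg : {compact-open, filter_from D B --> sigL H G}.
  apply/(compact_open_fam_compactP _ FF); first exact: holomorphic_continuous.
  apply/fam_cvgP => K cK P /uniform_nbhs [E [entE EP]].
  have [e e0 He] := entourage_cn entE.
  exists (K, e); first by split.
  by move=> h /= Hh; apply: EP => x Kx; apply: He; exact: Hh.
have [[K d] [/= cK d0] KV] := cvg V (open_nbhs_nbhs (conj oV VG)).
exists K, d => // F hF HF.
suff : (U `&` holomorphic_space R n) (sigL H F) by case.
by rewrite -VU; split; [exact: KV | exists F].
Qed.

Lemma holomorphic_translate F t : holomorphic_on H F -> holomorphic_on H (translate F t).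
Proof.
move=> hF z Hz; apply: differentiable_translate; apply: hF => j.
by rewrite /upper_half_plane /= !mxE ImB subr0; exact: Hz.
Qed.

Lemma compact_set_val (K : set H) : compact K -> compact (set_val @` K : set rV).
Proof.
move=> cK; apply: continuous_compact => //; apply: continuous_subspaceT.
exact: initial_continuous.
Qed.

End CompactOpen.

Lemma ler_addeps (R : realType) (a b : R) :
  (forall e : R, 0 < e -> a <= b + e) -> a <= b.
Proof. by move=> H; apply/ler_addgt0Pr. Qed.

(** The Cayley transform [u] of [h] is bounded by 1, so [cn (u s) <= 3 * cn s / r <= 3 / 8]. Solving
    [x <= cn (u s) * (x + 2 * Im q)] for [x = cn (h s - q)] gives the factor [6 / (1 - 3 / 8)],
    which is below 10. *)
Lemma half_plane_lipschitz (R : realType) (h : R[i] -> R[i]) (r : R) (s : R[i]) : 0 < r ->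
  (forall z, cn z < r -> exists k, cdiff h z k) ->
  (forall z, cn z < r -> 0 < complex.Im (h z)) -> cn s <= r / 8 ->
  cn (h s - h 0) <= 10 * cn s / r * complex.Im (h 0).
Proof.
move=> r0 dh Hh sr.
have q0 : 0 < complex.Im (h 0) by apply: Hh; rewrite cn0.
set q := h 0 in q0 *; set qc := complex.Re q +i* - complex.Im q.
have den z : cn z < r -> h z - qc != 0.
  move=> /Hh hz; rewrite -cn_gt0 (lt_le_trans _ (ler_Im_cn _)) // normr_gt0 gt_eqF //.
  by rewrite ImB /= opprK addr_gt0.
pose u z := (h z - q) / (h z - qc).
have u0 : u 0 = 0 by rewrite /u subrr mul0r.
have := @schwarz_square _ u 0 r 1 r0; rewrite u0 => H.
have us : cn (u s) <= 3 * cn s / r.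
  have -> : 3 * cn s / r = 3 * 1 / r * cn s by ring.
  have := H _ _ s; rewrite !subr0; apply; first last.
  - by apply: (le_lt_trans sr); move: r0; clear; lra.
  - move=> z; rewrite !subr0 => zr; rewrite cnM cnV ler_pdivrMr ?cn_gt0 ?den // mul1r.
    rewrite -(ler_sqr (cn_ge0 _) (cn_ge0 _)) cn_conj_sq lerDl.
    by rewrite !mulr_ge0 // ltW // Hh.
  - move=> z; rewrite subr0 => zr; have [k dk] := dh z zr; eexists; apply: cdiffM.
      by apply: cdiffB; [exact: dk | exact: cdiff_cst].
    apply: cdiffV; last exact: den.
    by apply: cdiffB; [exact: dk | exact: cdiff_cst].
have sr' : cn s < r by apply: (le_lt_trans sr); move: r0; clear; lra.
have E : cn (h s - q) = cn (u s) * cn (h s - qc) by rewrite -cnM /u divfK // den.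
have tri : cn (h s - qc) <= cn (h s - q) + 2 * complex.Im q.
  have -> : h s - qc = (h s - q) + (0 +i* (2 * complex.Im q)).
    by apply: complex_ext; rewrite ?(ReB, ReD, ImB, ImD) /=; ring.
  apply: (le_trans (cnD _ _)); rewrite lerD2l; apply: (le_trans (cn_le_ReIm _)).
  by rewrite /= normr0 add0r ger0_norm // mulr_ge0 // ltW.
have c0 := cn_ge0 (h s - q); have uge := cn_ge0 (u s).
have u38 : cn (u s) <= 3 / 8.
  apply: (le_trans us); rewrite ler_pdivrMr //; move: sr; clear; lra.
have := ler_wpM2l uge tri; rewrite -E.
have := ler_wpM2r c0 u38; have := ler_wpM2r (ltW q0) us.
have : 0 <= 3 * cn s / r * complex.Im q.
  by rewrite mulr_ge0 ?(ltW q0) // divr_ge0 ?mulr_ge0 ?cn_ge0 ?(ltW r0).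
have -> : 10 * cn s / r * complex.Im q = 10 / 3 * (3 * cn s / r * complex.Im q) by field; exact: lt0r_neq0.
by clear; lra.
Qed.

(** The right-hand side is linear in [x] and [y], so its average is controlled by their averages,
    which are small although those of [|x|] are not yet known to be. *)
Lemma norm_le_sub (R : realType) (x y e : R) :
  0 <= e -> y <= e -> y <= x -> `|x| <= x - 2 * y + 2 * e.
Proof. by move=> h0 h1 h2; rewrite ler_norml; apply/andP; split; lra. Qed.

(** The constant of [taylor2] for the bound [2 * y] on a disc of radius [y / (8 * rho)]. *)
Definition taylor_const (R : realType) : R := 144 * 2 * 64.

Lemma taylor_const_gt0 (R : realType) : 0 < taylor_const R.
Proof. by rewrite /taylor_const -!natrM ltr0n. Qed.

(** * Derivatives and bounds along the diagonal *)

Section HalfSpace.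
Variables (R : realType) (n : nat) (f : 'rV[R[i]]_n -> R[i]).
Hypothesis f_holo : holomorphic_on (upper_half_space R n) f.
Hypothesis f_half : forall z, upper_half_space R n z -> upper_half_plane R (f z).
Hypothesis f_diag : forall l, upper_half_plane R l -> f (const_mx l) = l.
Implicit Types (a v w : 'rV[R[i]]_n) (l s z : R[i]) (r m rho x y : R).

Definition coord_le v rho := forall j, cn (v ord0 j) <= rho.

Lemma half_space_perturb w v m rho : (forall j, m <= complex.Im (w ord0 j)) ->
  coord_le v rho -> rho < m -> upper_half_space R n (w + v).
Proof.
move=> Hw Hv rm j; rewrite /upper_half_plane /= mxE ImD.
have := Hw j; have := le_trans (ler_Im_cn _) (Hv j); rewrite ler_norml => /andP[h1 h2] h3.
by move: h1 h3 rm; lra.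
Qed.

Lemma coord_leZ v rho s : coord_le v rho -> coord_le (s *: v) (cn s * rho).
Proof. by move=> H j; rewrite mxE cnM ler_wpM2l ?cn_ge0. Qed.

Lemma coord_le0 v : coord_le v 0 -> v = 0.
Proof.
move=> H; apply/rowP => j; rewrite mxE; apply/eqP; rewrite -cn_eq0 eq_le cn_ge0.
by rewrite (H j).
Qed.

Lemma cdiff_f_line w v s : upper_half_space R n (w + s *: v) ->
  cdiff (fun k => f (w + k *: v)) s ('D_v f (w + s *: v)).
Proof. by move=> /f_holo; exact: cdiff_line. Qed.

(** The line through [w] in direction [v] stays in the half-space for parameters of modulus below
    [m / rho]; the case [rho = 0] is apart. The bound is relative to the height [m], so bounded
    shifts become harmless high up. *)
Lemma half_space_lipschitz w v m rho : 0 < m -> (forall j, m <= complex.Im (w ord0 j)) ->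
  0 <= rho -> coord_le v rho -> rho <= m / 8 ->
  cn (f (w + v) - f w) <= 10 * rho / m * complex.Im (f w).
Proof.
move=> m0 Hw; rewrite le_eqVlt => /predU1P[<- /coord_le0 -> _|rho0 Hv rm].
  by rewrite addr0 subrr cn0 mulr0 !mul0r.
have inH (s : R[i]) : cn s < m / rho -> upper_half_space R n (w + s *: v).
  by rewrite ltr_pdivlMr // => sm; exact: half_space_perturb Hw (coord_leZ _ Hv) sm.
have := @half_plane_lipschitz R (fun k => f (w + k *: v)) (m / rho) 1 (divr_gt0 m0 rho0).
rewrite cn1 scale1r scale0r addr0 mulr1 invf_div mulrA; apply.
- by move=> s /inH /cdiff_f_line; eauto.
- by move=> s /inH /f_half.
- by rewrite mulrAC ler_pdivlMr // mul1r.
Qed.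

Definition diag_partial (j : 'I_n) l := partial_derivative f j (const_mx l).

Lemma half_space_const l : 0 < complex.Im l -> upper_half_space R n (const_mx l).
Proof. by move=> l0 j; rewrite /upper_half_plane /= mxE. Qed.

(** On the parameter disc of radius [y / (8 * rho)] the Lipschitz estimate keeps [f - l] below
    [2 * y], and [rho < y / 48] puts the parameter 1 within a sixth of that radius. The decay in the
    height of [l] is the source of all limits at infinity below. *)
Lemma half_space_taylor l v rho : 0 < rho -> coord_le v rho -> rho < complex.Im l / 48 ->
  cn (f (const_mx l + v) - l - \sum_j v ord0 j * diag_partial j l) <=
  taylor_const R * rho ^+ 2 / complex.Im l.
Proof.
move=> rho0 Hv rl; set y := complex.Im l in rl *.
have y0 : 0 < y by move: rl rho0; lra.
pose h s := f (const_mx l + s *: v) - l.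
have r0 : 0 < y / (8 * rho) by rewrite divr_gt0 // mulr_gt0.
have Hl j : y <= complex.Im ((const_mx l : 'rV[R[i]]_n) ord0 j) by rewrite mxE.
have sle s : cn s < y / (8 * rho) -> cn s * rho < y / 8.
  by rewrite ltr_pdivlMr ?mulr_gt0 // mulrCA; move: (cn s * rho) => k; lra.
have fl := f_diag y0.
have := @taylor2 _ h 1 (\sum_j v ord0 j * diag_partial j l) (y / (8 * rho)) (2 * y) r0.
rewrite /h scale1r scale0r addr0 fl subrr subr0 mulr1 cn1 expr1n mulr1.
have -> : 144 * (2 * y) / (y / (8 * rho)) ^+ 2 = taylor_const R * rho ^+ 2 / y.
  by rewrite /taylor_const; field; rewrite !lt0r_neq0.
apply.
- move=> s /sle sy; eexists; apply: cdiffB; last exact: cdiff_cst.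
  apply: cdiff_f_line; apply: half_space_perturb Hl (coord_leZ _ Hv) _.
  by apply: lt_trans sy _; move: y0; lra.
- move=> s /sle sy; have := @half_space_lipschitz (const_mx l) (s *: v) y (cn s * rho) y0 Hl.
  rewrite mulr_ge0 ?cn_ge0 ?(ltW rho0) // => /(_ isT (coord_leZ _ Hv) (ltW sy)); rewrite fl -/y => H.
  by apply: (le_trans H); rewrite divfK ?lt0r_neq0 //; move: sy y0; lra.
- rewrite -[X in cdiff _ _ X]subr0; apply: cdiffB; last exact: cdiff_cst.
  have := @cdiff_f_line (const_mx l) v 0; rewrite scale0r addr0 derive_sum; last exact/f_holo/half_space_const.
  by apply; exact: half_space_const.
- have -> : y / (8 * rho) / 6 = y / 48 / rho by field; exact: lt0r_neq0.
  by rewrite ltr_pdivlMr // mul1r.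
Qed.

Definition real_vec a := forall j, complex.Im (a ord0 j) = 0.

Lemma coord_le_exists v : exists2 rho : R, 0 < rho & coord_le v rho.
Proof.
exists (1 + \sum_j cn (v ord0 j)).
  by rewrite ltr_wpDr // sumr_ge0 // => j _; exact: cn_ge0.
move=> j; rewrite (bigD1 j) //= addrCA ler_wpDr // addr_ge0 // sumr_ge0 // => k _.
exact: cn_ge0.
Qed.

Lemma const_mxZ l : const_mx l = l *: const_mx 1 :> 'rV[R[i]]_n.
Proof. by apply/rowP => j; rewrite !mxE mulr1. Qed.

Lemma cdiff_f_const a l : upper_half_space R n (a + const_mx l) ->
  exists k, cdiff (fun s => f (a + const_mx s)) l k.
Proof.
rewrite const_mxZ => /cdiff_f_line dk; eexists.
by apply: (@cdiff_ext _ _ _ _ _ 1 ltr01 _ dk) => s _; rewrite [in RHS]const_mxZ.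
Qed.

Lemma real_vec_half_space a l : real_vec a -> 0 < complex.Im l ->
  upper_half_space R n (a + const_mx l).
Proof. by move=> ra l0 j; rewrite /upper_half_plane /= !mxE ImD ra add0r. Qed.

(* Harnack's inequality between the height of [l] and a height tending to infinity,
   where [f] is close to the diagonal. *)
Lemma Im_ge_of_real_shift a l : real_vec a -> 0 < complex.Im l ->
  complex.Im l <= complex.Im (f (a + const_mx l)).
Proof.
move=> ra l0; set y := complex.Im l in l0 *; set x := complex.Re l.
have le : l = x +i* y by rewrite /x /y; case: (l).
have [rho rho0 Ha] := coord_le_exists a.
pose p s := f (a + const_mx s).
have pp : pick p.
  split=> s s0; first exact/cdiff_f_const/real_vec_half_space.
  exact/ltW/f_half/real_vec_half_space.
apply: ler_addeps => e e0.
(* The second term admits the Lipschitz estimate at height [Y]; the third makes its error,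
   [10 * rho * y] after Harnack, at most [e * Y]. *)
pose Y := y + 8 * rho + 10 * rho * y / e.
have ye : 0 < 10 * rho * y / e by rewrite divr_gt0 // !mulr_gt0.
have [yY rY Ye] : [/\ y <= Y, rho <= Y / 8 & 10 * rho * y <= e * Y].
  rewrite [e * Y]mulrC -(ler_pdivrMr _ _ e0).
  by split; rewrite /Y; lra.
have Y0 : 0 < Y := lt_le_trans l0 yY.
have Hc j : Y <= complex.Im ((const_mx (x +i* Y) : 'rV[R[i]]_n) ord0 j) by rewrite mxE.
have := half_space_lipschitz Y0 Hc (ltW rho0) Ha rY.
rewrite f_diag // (addrC (const_mx _)) -/(p _) /= divfK ?lt0r_neq0 //.
move=> /(le_trans (ler_Im_cn _)); rewrite ImB ler_norml /= => /andP[h _].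
have [+ _] := harnack x pp l0 yY; rewrite -le -/(p l).
set c := complex.Im (p l) => H.
have {}h : y * (Y - 10 * rho) <= y * complex.Im (p (x +i* Y)).
  by rewrite ler_wpM2l ?(ltW l0) //; lra.
rewrite -(ler_pM2l Y0); move: (le_trans h H); lra.
Qed.

(** By [Im_ge_of_real_shift] a real shift of either sign in one coordinate cannot lower the
    imaginary part below that of [l], so the term of first order in the shift has imaginary part
    zero. *)
Lemma diag_partial_real j l : 0 < complex.Im l -> complex.Im (diag_partial j l) = 0.
Proof.
move=> l0; set y := complex.Im l in l0 *.
pose D (t : R) : 'rV[R[i]]_n := t%:C *: delta_mx ord0 j.
have Dr t : real_vec (D t).
  by move=> k; rewrite !mxE; case: (_ && _); rewrite ?mulr1 ?mulr0.
have Dv t : coord_le (D t) `|t|.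
  move=> k; rewrite !mxE; case: (_ && _); rewrite ?mulr1 ?mulr0 ?cn0 //.
  by rewrite cn_real.
have DS t : \sum_k D t ord0 k * diag_partial k l = t%:C * diag_partial j l.
  rewrite (bigD1 j) //= big1 ?addr0 => [|k kj]; first by rewrite !mxE !eqxx mulr1.
  by rewrite !mxE (negPf kj) andbF mulr0 mul0r.
have main t : 0 < `|t| -> `|t| < y / 48 ->
    - (taylor_const R * `|t| ^+ 2 / y) <= t * complex.Im (diag_partial j l).
  move=> t0 ty; have := half_space_taylor t0 (Dv t) ty; rewrite DS.
  move=> /(le_trans (ler_Im_cn _)); rewrite !ImB ImZ ler_norml => /andP[_].
  by have := Im_ge_of_real_shift (Dr t) l0; rewrite (addrC (D t)) -/y; lra.
set b := complex.Im (diag_partial j l).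
have sgn (s : R) : `|s| = 1 -> 0 <= s * b.
  move=> s1; apply: ler_addeps => e e0; have T0 := taylor_const_gt0 R.
  pose t := Num.min (y / 96) (e * y / taylor_const R).
  have t0 : 0 < t by rewrite lt_min !divr_gt0 // mulr_gt0.
  have [t1 t2] : t <= y / 96 /\ t <= e * y / taylor_const R by rewrite !ge_min !lexx orbT.
  have nt : `|s * t| = t by rewrite normrM s1 mul1r ger0_norm // ltW.
  have := main (s * t); rewrite nt => /(_ t0) H.
  have {}H := H ltac:(lra).
  rewrite -(ler_pM2l t0) mulr0 mulrDr.
  have h2 : taylor_const R * t ^+ 2 / y <= t * e.
    rewrite ler_pdivrMr // expr2; move: t2; rewrite ler_pdivlMr // => t2.
    by have := ler_wpM2l (ltW t0) t2; lra.
  by move: H h2; rewrite -/b; lra.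
have := sgn 1 (normr1 _); have := sgn (-1) (normrN1 _); lra.
Qed.

(** The Pick function [q t] equals [t] times the derivative up to order [t ^+ 2]. As the derivative
    is real, the imaginary part of [q t] is itself of order [t ^+ 2], and Schwarz-Pick then makes
    [q t l - q t l'] of that order too. Dividing by [t] leaves a difference of order [t]. *)
Lemma diag_partial_const j l l' : 0 < complex.Im l -> 0 < complex.Im l' -> diag_partial j l = diag_partial j l'.
Proof.
move=> l0 l'0; apply/eqP; rewrite -subr_eq0 -cn_eq0 eq_le cn_ge0 andbT.
set y := complex.Im l in l0 *; set y' := complex.Im l' in l'0 *.
pose D (t : R) : 'rV[R[i]]_n := t%:C *: delta_mx ord0 j.
have Dr t : real_vec (D t).
  by move=> k; rewrite !mxE; case: (_ && _); rewrite ?mulr1 ?mulr0.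
have Dv t : coord_le (D t) `|t|.
  move=> k; rewrite !mxE; case: (_ && _); rewrite ?mulr1 ?mulr0 ?cn0 //.
  by rewrite cn_real.
have DS t k0 : \sum_k D t ord0 k * diag_partial k k0 = t%:C * diag_partial j k0.
  rewrite (bigD1 j) //= big1 ?addr0 => [|k kj]; first by rewrite !mxE !eqxx mulr1.
  by rewrite !mxE (negPf kj) andbF mulr0 mul0r.
pose q t s := f (D t + const_mx s) - s.
have qpick t : pick (q t).
  split=> s s0.
    have [k dk] := cdiff_f_const (real_vec_half_space (Dr t) s0).
    by eexists; apply: cdiffB; [exact: dk | exact: cdiff_id].
  by rewrite /q ImB subr_ge0; exact: Im_ge_of_real_shift.
have main t k0 : 0 < t -> t < complex.Im k0 / 48 ->
    cn (q t k0 - t%:C * diag_partial j k0) <= taylor_const R * t ^+ 2 / complex.Im k0 /\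
    complex.Im (q t k0) <= taylor_const R * t ^+ 2 / complex.Im k0.
  move=> t0 ty; have k00 : 0 < complex.Im k0 by lra.
  have nt : `|t| = t by rewrite ger0_norm // ltW.
  have := @half_space_taylor k0 (D t) `|t|; rewrite nt => /(_ t0).
  have Dvt := Dv t; rewrite nt in Dvt; move=> /(_ Dvt ty); rewrite DS (addrC (const_mx _)) -/(q t k0) => H; split => //.
  have := le_trans (ler_Im_cn _) H; rewrite ImB ImZ diag_partial_real // mulr0 subr0.
  by rewrite ler_norml => /andP[].
pose C : R := taylor_const R; have C0 : 0 < C := taylor_const_gt0 R.
pose K := cn (l - l') * (C / (y * y')) + C / y + C / y'.
have K0 : 0 <= K.
  have yy : 0 <= y * y' by rewrite mulr_ge0 // ltW.
  rewrite addr_ge0 ?divr_ge0 ?(ltW C0) ?(ltW l'0) // addr_ge0 ?divr_ge0 ?(ltW C0) ?(ltW l0) //.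
  by rewrite mulr_ge0 ?cn_ge0 // divr_ge0 // ltW.
have bound t : 0 < t -> t < y / 48 -> t < y' / 48 -> cn (diag_partial j l - diag_partial j l') <= K * t.
  move=> t0 ty ty'; have [h1 h2] := main t l t0 ty; have [h3 h4] := main t l' t0 ty'.
  have SP := @schwarz_pick _ (q t) l l' (qpick t) l0 l'0.
  have a0 : 0 <= complex.Im (q t l) by apply: (qpick t).2.
  have b0 : 0 <= complex.Im (q t l') by apply: (qpick t).2.
  have yy0 : 0 < y * y' by rewrite mulr_gt0.
  have h5 : cn (q t l - q t l') <= cn (l - l') * (C / (y * y')) * t ^+ 2.
    rewrite -(ler_sqr (cn_ge0 _)) ?nnegrE; last first.
      by rewrite !mulr_ge0 ?invr_ge0 ?mulr_ge0 ?cn_ge0 ?exprn_ge0 ?(ltW C0) ?(ltW t0) ?(ltW l0) ?(ltW l'0).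
    rewrite -(ler_pM2r yy0); apply: (le_trans SP).
    have -> : (cn (l - l') * (C / (y * y')) * t ^+ 2) ^+ 2 * (y * y') =
        cn (l - l') ^+ 2 * ((C * t ^+ 2 / y) * (C * t ^+ 2 / y')).
      by field; rewrite !lt0r_neq0.
    by rewrite ler_wpM2l ?exprn_ge0 ?cn_ge0 // ler_pM.
  rewrite -(ler_pM2l t0) -{1}[t]gtr0_norm // -cn_real -cnM mulrBr.
  have via (a b u v : R[i]) : u - v = (a - b) - (a - u) + (b - v) by ring.
  rewrite (via (q t l) (q t l')).
  apply: (le_trans (cnD _ _)); apply: (le_trans (lerD (cnB _ _) (lexx _))).
  apply: (le_trans (lerD (lerD h5 h1) h3)).
  have -> : t * (K * t) = cn (l - l') * (C / (y * y')) * t ^+ 2 + C * t ^+ 2 / y + C * t ^+ 2 / y'.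
    by rewrite /K; field; rewrite !lt0r_neq0.
  by rewrite /C.
apply: ler_addeps => e e0; rewrite add0r.
pose t := Num.min (Num.min (y / 96) (y' / 96)) (e / (K + 1)).
have K1 : 0 < K + 1 by rewrite ltr_wpDl.
have t0 : 0 < t by rewrite !lt_min !divr_gt0.
have [t1 t2 t3] : [/\ t <= y / 96, t <= y' / 96 & t <= e / (K + 1)].
  by rewrite !ge_min !lexx !orbT.
have ty : t < y / 48 by lra.
have ty' : t < y' / 48 by lra.
apply: (le_trans (bound t t0 ty ty')).
move: t3; rewrite ler_pdivlMr // => t3; rewrite mulrC; move: t3 t0; rewrite mulrDr; lra.
Qed.

Lemma half_space_min w : upper_half_space R n w ->
  exists2 m : R, 0 < m & forall j, m <= complex.Im (w ord0 j).
Proof.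
move=> Hw; exists (\big[Num.min/1]_j complex.Im (w ord0 j)).
  by apply/bigmin_gtP; split => // j _; exact: Hw.
by move=> j; exact: bigmin_le.
Qed.

(** The sum is the derivative of [f] along the diagonal, where [f] is the identity. *)
Lemma diag_partial_sum l : 0 < complex.Im l -> \sum_j diag_partial j l = 1.
Proof.
move=> l0; apply/eqP; rewrite -subr_eq0 -cn_eq0 eq_le cn_ge0 andbT.
set y := complex.Im l in l0 *; set S := \sum_j _.
have main (t : R) : 0 < t -> t < y / 48 -> cn (S - 1) <= taylor_const R / y * t.
  move=> t0 ty; have Dv : coord_le (const_mx t%:C) t.
    by move=> j; rewrite mxE cn_real gtr0_norm.
  have := half_space_taylor t0 Dv ty.
  rewrite -[const_mx l + _](_ : const_mx (l + t%:C) = _); last by apply/rowP => j; rewrite !mxE.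
  rewrite f_diag; last by rewrite /upper_half_plane /= ImD /= addr0.
  under eq_bigr do rewrite mxE.
  rewrite -mulr_sumr -/S -/y.
  have E (a b u : R[i]) : a + b - a - b * u = - (b * (u - 1)) by ring.
  rewrite E cnN cnM cn_real gtr0_norm // -(ler_pM2l t0) => h.
  rewrite -(ler_pM2l t0) -(ler_pM2l t0); apply: (le_trans h).
  by rewrite le_eqVlt; apply/orP; left; apply/eqP; field; exact: lt0r_neq0.
apply: ler_addeps => e e0; rewrite add0r; have T0 := taylor_const_gt0 R.
pose t := Num.min (y / 96) (e * y / taylor_const R).
have t0 : 0 < t by rewrite lt_min !divr_gt0 // mulr_gt0.
have [t1 t2] : t <= y / 96 /\ t <= e * y / taylor_const R by rewrite !ge_min !lexx orbT.
have ty : t < y / 48 by lra.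
apply: (le_trans (main t t0 ty)).
move: t2; rewrite ler_pdivlMr // => t2.
by rewrite mulrAC ler_pdivrMr // mulrC.
Qed.

(** [tangent] is the map g and [defect] the function psi of the overview. *)
Definition tangent w : R[i] := \sum_j diag_partial j 'i * w ord0 j.
Definition defect w := f w - tangent w.

Lemma Im_i : 0 < complex.Im ('i : R[i]). Proof. exact: ltr01. Qed.

Lemma tangentD w w' : tangent (w + w') = tangent w + tangent w'.
Proof. by rewrite /tangent -big_split; apply: eq_bigr => j _; rewrite mxE mulrDr. Qed.

Lemma tangent_const l : tangent (const_mx l) = l.
Proof.
rewrite /tangent; under eq_bigr do rewrite mxE.
by rewrite -mulr_suml diag_partial_sum ?mul1r // Im_i.
Qed.

Lemma defect_shift w l : defect (w + const_mx l) = f (w + const_mx l) - l - tangent w.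
Proof. by rewrite /defect tangentD tangent_const; ring. Qed.

(** Because the derivatives are constant along the diagonal, the Taylor expansion at [l] has the
    same linear part as [tangent], which is taken at ['i]. *)
Lemma defect_far w l rho : 0 < rho -> coord_le w rho -> rho < complex.Im l / 48 ->
  cn (defect (w + const_mx l)) <= taylor_const R * rho ^+ 2 / complex.Im l.
Proof.
move=> rho0 Hw rl; have l0 : 0 < complex.Im l by lra.
have := half_space_taylor rho0 Hw rl; rewrite defect_shift (addrC (const_mx l)) /tangent.
congr (cn (_ - _) <= _); apply: eq_bigr => j _.
by rewrite mulrC (diag_partial_const j l0 Im_i).
Qed.

Lemma half_space_up w m l : (forall j, m <= complex.Im (w ord0 j)) -> - m < complex.Im l ->
  upper_half_space R n (w + const_mx l).
Proof.
by move=> Hw ml j; rewrite /upper_half_plane /= !mxE ImD; have := Hw j; lra.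
Qed.

(** From height [49 * rho] on, [defect_far] suffices. A lower point is compared with the one
    [49 * rho] above it: Harnack bounds the imaginary part of [f] at the lower point by that at the
    upper one, and Schwarz-Pick then bounds the difference of the values. *)
Lemma defect_bounded w : upper_half_space R n w -> exists2 K : R, 0 < K &
  forall l, 0 <= complex.Im l -> cn (defect (w + const_mx l)) <= K.
Proof.
move=> /half_space_min [m m0 Hm]; have [rho rho0 Hr] := coord_le_exists w.
pose C : R := taylor_const R; have C0 : 0 < C := taylor_const_gt0 R.
(* [B] bounds Im f at the upper point, where the shift has imaginary part at most [98 * rho]; [c]
   below bounds the Harnack ratio [Y / y], and [K1] is the resulting Schwarz-Pick bound. *)
pose B := 98 * rho + cn (tangent w) + C * rho.
have B0 : 0 < B.
  by apply: addr_gt0; [apply: ltr_pwDl; [exact: mulr_gt0 | exact: cn_ge0] | exact: mulr_gt0].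
pose c := 1 + 98 * rho / m.
have c0 : 0 < c by rewrite addr_gt0 // divr_gt0 // mulr_gt0.
pose K1 := 49 * rho * (c + 1) * B * (2 / m).
have K10 : 0 < K1 by rewrite !mulr_gt0 ?invr_gt0 // addr_gt0.
exists (C * rho + K1 + 49 * rho) => [|l l0].
  by apply: addr_gt0; [apply: addr_gt0; [exact: mulr_gt0 | exact: K10] | exact: mulr_gt0].
have far l' : 49 * rho <= complex.Im l' -> cn (defect (w + const_mx l')) <= C * rho.
  move=> l'r; have l'0 : 0 < complex.Im l' by lra.
  apply: (le_trans (defect_far rho0 Hr _)); first by lra.
  have h1 : rho <= complex.Im l' by lra.
  have := ler_wpM2l (ltW C0) (ler_wpM2l (ltW rho0) h1).
  by rewrite ler_pdivrMr // -/C expr2 !mulrA.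
have [lr|lr] := leP (49 * rho) (complex.Im l).
  apply: (le_trans (far l lr)); rewrite -addrA lerDl addr_ge0 ?(ltW K10) //.
  by rewrite mulr_ge0 // ltW.
set x := complex.Re l; set y := complex.Im l + m / 2.
have y0 : m / 2 <= y by rewrite /y; lra.
have y0' : 0 < y by apply: lt_le_trans y0; rewrite divr_gt0.
set Y := y + 49 * rho.
have yY : y <= Y by rewrite /Y lerDl mulr_ge0 // ltW.
have Y0 : 0 < Y := lt_le_trans y0' yY.
(* Lowering by [m / 2] stays inside the half-space and gives both points heights of at least [m / 2]
   as arguments of [P], uniformly in [l]. *)
pose P s := f (w + const_mx (s - (0 +i* (m / 2)))).
have PH s : 0 < complex.Im s -> upper_half_space R n (w + const_mx (s - (0 +i* (m / 2)))).
  by move=> s0; apply: half_space_up Hm _; rewrite ImB /=; lra.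
have Pp : pick P.
  split=> s s0; last exact/ltW/f_half/PH.
  have [k dk] := cdiff_f_const (PH s s0); eexists.
  apply: (@cdiff_comp _ (fun s => s - (0 +i* (m / 2))) (fun s => f (w + const_mx s)) s _ _ _ dk).
  by apply: cdiffB; [exact: cdiff_id | exact: cdiff_cst].
pose l' := l + (0 +i* (49 * rho)).
have Pl : P (x +i* y) = f (w + const_mx l).
  congr (f (w + const_mx _)); apply: complex_ext; rewrite ?ReB ?ImB /= ?subr0 //.
  by rewrite /y addrK.
have Pl' : P (x +i* Y) = f (w + const_mx l').
  congr (f (w + const_mx _)); apply: complex_ext; rewrite /l' ?ReB ?ImB ?ReD ?ImD /= ?subr0 ?addr0 //.
  by rewrite /Y /y; ring.
have [_ har] := harnack x Pp y0' yY.
have far' : cn (defect (w + const_mx l')) <= C * rho.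
  by apply: far; rewrite ImD /=; lra.
have b1 : complex.Im (P (x +i* Y)) <= B.
  rewrite Pl'; have -> : f (w + const_mx l') = defect (w + const_mx l') + tangent w + l'.
    by rewrite defect_shift; ring.
  have := le_trans (ler_norm _) (ler_Im_cn (defect (w + const_mx l'))).
  have := le_trans (ler_norm _) (ler_Im_cn (tangent w)).
  by rewrite !ImD /= /B; lra.
set b := complex.Im (P (x +i* Y)) in har b1.
set a := complex.Im (P (x +i* y)) in har.
have a0 : 0 <= a by apply: Pp.2.
have b0 : 0 <= b by apply: Pp.2.
have ac : a <= c * b.
  rewrite -(ler_pM2l y0'); apply: (le_trans har); rewrite mulrA ler_wpM2r //.
  rewrite /Y /c mulrDr mulr1 lerD2l.
  have -> : y * (98 * rho / m) = 98 * rho / m * y by ring.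
  have -> : 49 * rho = 98 * rho / m * (m / 2) by field; exact: lt0r_neq0.
  by rewrite ler_wpM2l // divr_ge0 ?(ltW m0) // mulr_ge0 // ltW.
have SP := @schwarz_pick _ P (x +i* y) (x +i* Y) Pp y0' Y0.
have dP : cn (P (x +i* y) - P (x +i* Y)) <= K1.
  rewrite -(ler_sqr (cn_ge0 _)) ?nnegrE ?(ltW K10) //.
  have m2 : (m / 2) ^+ 2 <= y * Y.
    by rewrite expr2 ler_pM ?divr_ge0 ?(ltW m0) // (le_trans y0).
  have m20 : 0 < (m / 2) ^+ 2 by rewrite exprn_gt0 // divr_gt0.
  rewrite -(ler_pM2r m20).
  apply: (@le_trans _ _ (cn (P (x +i* y) - P (x +i* Y)) ^+ 2 * (y * Y))).
    by rewrite ler_wpM2l ?exprn_ge0 ?cn_ge0.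
  apply: (le_trans SP).
  have -> : K1 ^+ 2 * (m / 2) ^+ 2 = (49 * rho) ^+ 2 * (((c + 1) * B) * ((c + 1) * B)).
    by rewrite /K1; field; exact: lt0r_neq0.
  have -> : cn (x +i* y - x +i* Y) ^+ 2 = (49 * rho) ^+ 2.
    by rewrite sqr_cn ReB ImB /= subrr expr0n /= add0r /Y; ring.
  rewrite ler_wpM2l ?sqr_ge0 // -/a -/b.
  apply: ler_pM => //.
    apply: (le_trans ac); rewrite ler_pM ?(ltW c0) // lerDl //.
  apply: (le_trans b1); rewrite -[X in X <= _]mul1r ler_wpM2r ?(ltW B0) // lerDr ltW //.
have -> : defect (w + const_mx l) = defect (w + const_mx l') +
    (P (x +i* y) - P (x +i* Y)) + (0 +i* (49 * rho)).
  by rewrite !defect_shift Pl Pl' /l'; ring.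
apply: (le_trans (cnD _ _)); apply: lerD.
  by apply: (le_trans (cnD _ _)); apply: lerD.
apply: (le_trans (cn_le_ReIm _)); rewrite /= normr0 add0r ger0_norm // mulr_ge0 // ltW //.
Qed.

(** * Averages over translations *)

(** The threshold [r0] is uniform in the starting point; [stretch_upper_bound] uses windows of one
    fixed length at every position. *)
Definition vanishing_mean (F : R -> R[i]) := forall eta : R, 0 < eta ->
  exists2 r0 : R, 0 < r0 & forall r t0, r0 <= r -> cn (cint F t0 (t0 + r)) <= eta * r.

(* Cauchy's theorem moves the segment of integration down to height [- Y]. *)
Lemma vanishing_mean_holo (F : R[i] -> R[i]) (K : R) :
  (forall z, complex.Im z <= 0 -> exists k, cdiff F z k) ->
  (forall z, complex.Im z <= 0 -> cn (F z) <= K) ->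
  (forall e : R, 0 < e -> exists2 Y : R, 0 < Y & forall x, cn (F (x +i* - Y)) <= e) ->
  vanishing_mean (fun t => F t%:C).
Proof.
move=> dF bF vF eta eta0; have [Y Y0 HY] := vF (eta / 4) ltac:(by rewrite divr_gt0).
have K0 : 0 <= K by apply: (le_trans (cn_ge0 _) (bF 0 _)).
(* The side at height [- Y] contributes at most [eta * r / 2] and the vertical sides at most
   [4 * K * Y], which this threshold also keeps below [eta * r / 2]. *)
exists (8 * (K + 1) * Y / eta) => [|r t0 rr].
  by rewrite divr_gt0 // !mulr_gt0 // ltr_wpDl.
have r0 : 0 < r by apply: lt_le_trans rr; rewrite divr_gt0 // !mulr_gt0 // ltr_wpDl.
have cF z : in_rect t0 (t0 + r) (- Y) 0 z -> ccont F z.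
  by move=> /andP[_ /andP[_ z0]]; have [k /cdiff_ccont] := dF z z0.
have tr : t0 <= t0 + r by rewrite lerDl ltW.
have Yn : - Y <= 0 by rewrite oppr_le0 ltW.
have : rect F t0 (t0 + r) (- Y) 0 = 0.
  apply: goursat; rewrite ?ltrDl ?oppr_lt0 // => z /andP[_ /andP[_ z0]]; exact: dF.
have hY : pcont_on t0 (t0 + r) (fun x => F (x +i* - Y)).
  by apply: (pcont_on_h cF); rewrite lexx.
have h0 : pcont_on t0 (t0 + r) (fun x => F (x +i* 0)).
  by apply: (pcont_on_h cF); rewrite lexx Yn.
rewrite /rect (cintB hY h0).
set A := cint _ _ _; set B := cint (fun x => F (x +i* 0)) _ _; set D := cint _ _ _.
move=> E; have {E}E : B = A + 'i * D.
  by apply/eqP; rewrite eq_sym -subr_eq0 -E; apply/eqP; ring.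
change (cn B <= eta * r); rewrite E.
have cA : cn A <= 2 * (eta / 4) * (t0 + r - t0) by apply: cn_cint_le.
have cD : cn D <= 2 * (2 * K) * (0 - - Y).
  apply: cn_cint_le => //.
    by apply: pcont_onB; apply: (pcont_on_v cF); rewrite lexx ?tr.
  move=> y /andP[_ y0]; apply: (le_trans (cnB _ _)).
  by rewrite mulr2n mulrDl mul1r lerD // bF.
apply: (le_trans (cnD _ _)); rewrite cnM cn_i mul1r; apply: (le_trans (lerD cA cD)).
move: rr; rewrite ler_pdivrMr //.
have KY : 0 <= K * Y by rewrite mulr_ge0 // ltW.
lra.
Qed.

(** As [s] is subtracted, moving it into the lower half-plane moves the point upwards. *)
Definition shifted w (s : R[i]) := defect (w - const_mx s).

Lemma shiftedE w s : shifted w s = f (w + const_mx (- s)) + s - tangent w.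
Proof. by rewrite /shifted -raddfN /= defect_shift opprK. Qed.

Lemma cdiff_shifted w s : upper_half_space R n w -> complex.Im s <= 0 ->
  exists k, cdiff (shifted w) s k.
Proof.
move=> /half_space_min [m m0 Hm] s0.
have Hs : upper_half_space R n (w + const_mx (- s)).
  by apply: half_space_up Hm _; rewrite ImN; lra.
have [k dk] := cdiff_f_const Hs; eexists.
apply: (@cdiff_ext _ (fun s => f (w + const_mx (- s)) + s - tangent w) _ _ _ 1 ltr01).
  by move=> t _; rewrite shiftedE.
apply: cdiffB; last exact: cdiff_cst.
apply: cdiffD; last exact: cdiff_id.
apply: (@cdiff_comp _ (fun s => - s) (fun s => f (w + const_mx s)) s _ _ _ dk).
by apply: cdiffN; exact: cdiff_id.
Qed.

Lemma shifted_bounded w : upper_half_space R n w -> exists2 K : R, 0 < K &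
  forall s, complex.Im s <= 0 -> cn (shifted w s) <= K.
Proof.
move=> /defect_bounded [K K0 HK]; exists K => // s s0.
by rewrite /shifted -raddfN; apply: HK; rewrite ImN oppr_ge0.
Qed.

Lemma shifted_far w (e : R) : 0 < e ->
  exists2 Y : R, 0 < Y & forall x, cn (shifted w (x +i* - Y)) <= e.
Proof.
move=> e0; have [rho rho0 Hr] := coord_le_exists w.
pose C : R := taylor_const R * rho ^+ 2.
have C0 : 0 < C by rewrite mulr_gt0 ?taylor_const_gt0 // exprn_gt0.
have Ce : 0 < C / e by rewrite divr_gt0.
have rr : 0 < 96 * rho by rewrite mulr_gt0.
exists (96 * rho + C / e) => [|x]; first exact: addr_gt0.
rewrite /shifted -raddfN /=; apply: (le_trans (defect_far rho0 Hr _)).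
  by rewrite /= opprK; lra.
rewrite -/C /= opprK ler_pdivrMr; last exact: addr_gt0.
rewrite mulrDr (mulrC e (C / e)) divfK ?lt0r_neq0 // lerDr.
by rewrite mulr_ge0 // ltW.
Qed.

Lemma vanishing_mean_shifted w : upper_half_space R n w ->
  vanishing_mean (fun t => shifted w t%:C).
Proof.
move=> Hw; have [K _ HK] := shifted_bounded Hw.
apply: (@vanishing_mean_holo (shifted w) K) => //.
- by move=> z; exact: cdiff_shifted.
- by move=> e; exact: shifted_far.
Qed.

Lemma vanishing_mean_shifted_sqr w : upper_half_space R n w ->
  vanishing_mean (fun t => shifted w t%:C ^+ 2).
Proof.
move=> Hw; have [K K0 HK] := shifted_bounded Hw.
apply: (@vanishing_mean_holo (fun s => shifted w s ^+ 2) (K ^+ 2)).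
- move=> z z0; have [k dk] := cdiff_shifted Hw z0; exact: cdiffX dk.
- by move=> z z0; rewrite cnX lerXn2r ?nnegrE ?cn_ge0 ?(ltW K0) // HK.
- move=> e e0; have [|Y Y0 HY] := @shifted_far w (Num.min e 1).
    by rewrite lt_min e0 ltr01.
  exists Y => // x; rewrite cnX expr2; have := HY x; rewrite le_min => /andP[h1 h2].
  by rewrite (le_trans _ h1) // ler_piMl ?cn_ge0.
Qed.

Lemma pcont_shifted w (a b : R) : upper_half_space R n w -> pcont_on a b (fun t => shifted w t%:C).
Proof.
move=> Hw t _; apply: (@pcont_path _ (shifted w) (fun t => t%:C)).
  by move=> s; rewrite -rmorphB /= expr0n /= addr0 sqrtr_sqr.
have [|k /cdiff_ccont //] := @cdiff_shifted w t%:C Hw.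
by rewrite /=.
Qed.

Definition stretch c w : 'rV[R[i]]_n :=
  \row_j (complex.Re (w ord0 j) +i* (c * complex.Im (w ord0 j))).

Lemma stretch_half_space c w : 0 < c -> upper_half_space R n w ->
  upper_half_space R n (stretch c w).
Proof. by move=> c0 Hw j; rewrite /upper_half_plane /= mxE /= mulr_gt0 //; exact: Hw. Qed.

(** The derivatives are real, so the imaginary part of [tangent] sees only the imaginary parts of
    the coordinates. *)
Lemma Im_tangent_stretch c w :
  complex.Im (tangent (stretch c w)) = c * complex.Im (tangent w).
Proof.
have ImS (F : 'I_n -> R[i]) : complex.Im (\sum_j F j) = \sum_j complex.Im (F j).
  by apply: (big_morph (@complex.Im R)) => // *; exact: ImD.
rewrite !ImS mulr_sumr; apply: eq_bigr => j _.
by rewrite !ImM (diag_partial_real j Im_i) mxE /= !mul0r !addr0 mulrCA.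
Qed.

(** The two points have parameters [c * 'i] and ['i] on the complex line [a + s *: v] with [a] real
    and [v] positive, and on that line [f] is a Pick function. *)
Lemma harnack_stretch c w t : 1 <= c -> upper_half_space R n w ->
  complex.Im (f (stretch c w - const_mx t%:C)) <= c * complex.Im (f (w - const_mx t%:C)).
Proof.
move=> c1 Hw; pose a : 'rV[R[i]]_n := \row_j (complex.Re (w ord0 j) - t)%:C.
pose v : 'rV[R[i]]_n := \row_j (complex.Im (w ord0 j))%:C.
have H s : 0 < complex.Im s -> upper_half_space R n (a + s *: v).
  move=> s0 j; rewrite /upper_half_plane /= !mxE ImD ImM /= mulr0 !add0r mulr_gt0 //.
  exact: Hw.
have Pp : pick (fun s => f (a + s *: v)).
  split=> s /H; first by move=> /cdiff_f_line; eauto.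
  by move=> /f_half/ltW.
have := (harnack 0 Pp ltr01 c1).1; rewrite mul1r.
congr (complex.Im (f _) <= c * complex.Im (f _)); apply/rowP => j;
  by rewrite !mxE; apply: complex_ext; rewrite ?ReB ?ImB ?ReD ?ImD ?ReM ?ImM /=; ring.
Qed.

Lemma const_mxB_real w t t' : w - const_mx (t + t')%:C = w - const_mx t%:C - const_mx t'%:C.
Proof. by apply/rowP => j; rewrite !mxE rmorphD opprD addrA. Qed.

Lemma half_space_real_shift w t : upper_half_space R n w ->
  upper_half_space R n (w - const_mx t%:C).
Proof. by move=> Hw j; rewrite /upper_half_plane /= !mxE ImB subr0; exact: Hw. Qed.

Lemma Im_shifted w t :
  complex.Im (shifted w t%:C) = complex.Im (f (w - const_mx t%:C)) - complex.Im (tangent w).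
Proof.
by rewrite /shifted -raddfN /= defect_shift !ImB -rmorphN /= subr0.
Qed.

Lemma Im_stretch_le c w t : 1 <= c -> upper_half_space R n w ->
  complex.Im (shifted (stretch c w) t%:C) <= c * complex.Im (shifted w t%:C).
Proof.
move=> c1 Hw; rewrite !Im_shifted Im_tangent_stretch mulrBr lerD2r.
exact: harnack_stretch.
Qed.

(* Averaging [Im_stretch_le] over a long interval of shifts, along which the left-
   hand side hardly moves. *)
Lemma stretch_upper_bound w (e : R) : upper_half_space R n w -> 0 < e ->
  exists2 c : R, 1 <= c & forall t, complex.Im (shifted (stretch c w) t%:C) <= c * e.
Proof.
move=> Hw e0; have [m m0 Hm] := half_space_min Hw.
have [K K0 HK] := shifted_bounded Hw.
have [S S0 HS] := vanishing_mean_shifted Hw (divr_gt0 e0 (ltr0Sn _ 1)).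
pose L := K + cn (tangent w).
have L0 : 0 < L by rewrite ltr_wpDr ?cn_ge0.
have fL t : complex.Im (f (w - const_mx t%:C)) <= L.
  have := le_trans (le_trans (ler_norm _) (ler_Im_cn _)) (HK t%:C (lexx 0)).
  by have := le_trans (ler_norm _) (ler_Im_cn (tangent w)); rewrite Im_shifted /L; lra.
(* The window length [S] is already fixed. The second term makes [S <= c * m / 8], as the Lipschitz
   estimate at height [c * m] requires; the third keeps the change over the window below
   [c * e / 2]. *)
pose c := 1 + 8 * S / m + 20 * S * L / (m * e).
have q1 : 0 < 8 * S / m by rewrite divr_gt0 // mulr_gt0.
have q2 : 0 < 20 * S * L / (m * e) by rewrite divr_gt0 // !mulr_gt0.
have c1 : 1 <= c by rewrite /c; lra.
have c0 : 0 < c by lra.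
have cS : S <= c * m / 8.
  rewrite /c; have : 8 * S / m * m = 8 * S by rewrite divfK // lt0r_neq0.
  have : 0 <= 20 * S * L / (m * e) * m by rewrite mulr_ge0 // ltW.
  by lra.
have cL : 10 * S * L / m <= c * e / 2.
  have -> : 10 * S * L / m = 20 * S * L / (m * e) * e / 2.
    by field; rewrite !lt0r_neq0.
  rewrite ler_pM2r ?invr_gt0 // ler_pM2r // /c; lra.
have Hc := stretch_half_space c0 Hw.
exists c => // t.
set b := complex.Im (shifted (stretch c w) t%:C).
(* A large [b] at the single shift [t] would force large values of Im psi at [w] throughout the
   window, where their mean is at most [e / 2]. *)
have low (s : R) : t <= s <= t + S -> (b - c * e / 2) / c <= complex.Im (shifted w s%:C).
  move=> /andP[ts sS]; rewrite ler_pdivrMr // [X in _ <= X]mulrC.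
  apply: le_trans (Im_stretch_le s c1 Hw).
  have cm0 : 0 < c * m by rewrite mulr_gt0.
  have P1 j : c * m <= complex.Im ((stretch c w - const_mx t%:C) ord0 j).
    by rewrite !mxE ImB /= subr0 ler_pM2l.
  have P2 : 0 <= s - t by rewrite subr_ge0.
  have P3 : coord_le (- const_mx (s - t)%:C) (s - t).
    by move=> j; rewrite !mxE cnN cn_real ger0_norm.
  have P4 : s - t <= c * m / 8 by apply: le_trans cS; lra.
  have := half_space_lipschitz cm0 P1 P2 P3 P4.
  rewrite -const_mxB_real subrKC.
  move=> /(le_trans (ler_Im_cn _)); rewrite ImB ler_norml => /andP[h _].
  have h1 : complex.Im (f (stretch c w - const_mx t%:C)) <= c * L.
    by apply: (le_trans (harnack_stretch t c1 Hw)); rewrite ler_pM2l.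
  have h2 : 10 * (s - t) / (c * m) * complex.Im (f (stretch c w - const_mx t%:C)) <= 10 * S * L / m.
    apply: (@le_trans _ _ (10 * S / (c * m) * (c * L))); last first.
      by rewrite le_eqVlt; apply/orP; left; apply/eqP; field; rewrite !lt0r_neq0.
    apply: ler_pM => //.
    - by rewrite divr_ge0 ?(ltW cm0) // mulr_ge0.
    - exact/ltW/f_half/half_space_real_shift.
    - by rewrite ler_pM2r ?invr_gt0 // ler_pM2l //; lra.
  by rewrite /b !Im_shifted; move: h h2 cL; lra.
have cw := @pcont_shifted _ t (t + S) Hw.
have tS : t <= t + S by rewrite lerDl ltW.
have h1 := rint_ge tS (pcont_on_Im cw) low.
have h2 := le_trans (le_trans (ler_norm _) (ler_Im_cn _)) (HS S t (lexx _)).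
have := le_trans h1 h2; rewrite (_ : t + S - t = S); last by rewrite addrAC subrr add0r.
rewrite ler_pM2r // ler_pdivrMr //; lra.
Qed.

(** The squared modulus is [2 * (E t * E t) + Q t]. One factor [E t] is bounded by [K], the other by
    [norm_le_sub] with [y = B t / c], and each of [E], [B], [Q] has vanishing mean. *)
Lemma mean_square w : upper_half_space R n w -> forall eta : R, 0 < eta ->
  exists2 r0 : R, 0 < r0 & forall r t0, r0 <= r ->
    rint (fun t => cn (shifted w t%:C) ^+ 2) t0 (t0 + r) <= eta * r.
Proof.
move=> Hw eta eta0; have [K K0 HK] := shifted_bounded Hw.
(* The estimates below add up to [(10 * K + 1) * e * r], hence to at most [eta * r]. *)
pose e := eta / (14 * K + 1).
have D0 : 0 < 14 * K + 1 by rewrite addr_gt0 // mulr_gt0.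
have e0 : 0 < e by rewrite divr_gt0.
have [c c1 Hc] := stretch_upper_bound Hw e0.
have c0 : 0 < c by lra.
have Hcw := stretch_half_space c0 Hw.
have [r1 r10 H1] := vanishing_mean_shifted Hw e0.
have [r2 r20 H2] := vanishing_mean_shifted Hcw e0.
have [r3 r30 H3] := vanishing_mean_shifted_sqr Hw e0.
exists (Num.max r1 (Num.max r2 r3)) => [|r t0]; first by rewrite lt_max r10.
rewrite !ge_max => /and3P[/(H1 _ t0) {}H1 /(H2 _ t0) {}H2 /(H3 _ t0) {}H3].
have r0 : 0 <= r.
  have := le_trans (cn_ge0 _) H1; by rewrite pmulr_rge0.
have tr : t0 <= t0 + r by rewrite lerDl.
have cD := @pcont_shifted _ t0 (t0 + r) Hw.
have cB := @pcont_shifted _ t0 (t0 + r) Hcw.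
have cS : pcont_on t0 (t0 + r) (fun t => shifted w t%:C ^+ 2).
  move=> t _; apply: (@pcont_path _ (fun s => shifted w s ^+ 2) (fun t => t%:C)).
    by move=> s; rewrite -rmorphB cn_real.
  have [|k /cdiff_ccont ck] := @cdiff_shifted w t%:C Hw; first by rewrite /=.
  exact: ccontX.
pose E t := complex.Im (shifted w t%:C).
pose B t := complex.Im (shifted (stretch c w) t%:C).
pose Q t := complex.Re (shifted w t%:C ^+ 2).
have cE : rcontinuous_on t0 (t0 + r) E := pcont_on_Im cD.
have cB' : rcontinuous_on t0 (t0 + r) B := pcont_on_Im cB.
have cQ : rcontinuous_on t0 (t0 + r) Q := pcont_on_Re cS.
have rI : `|rint E t0 (t0 + r)| <= e * r by apply: le_trans H1; exact: (ler_Im_cn (cint _ _ _)).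
have rB : `|rint B t0 (t0 + r)| <= e * r by apply: le_trans H2; exact: (ler_Im_cn (cint _ _ _)).
have rQ : `|rint Q t0 (t0 + r)| <= e * r by apply: le_trans H3; exact: (ler_Re_cn (cint _ _ _)).
have cont1 : rcontinuous_on t0 (t0 + r) (fun t => E t - (2 / c) * B t).
  by move=> t tt; apply: continuousB; [exact: cE | apply: continuousM; [exact: cst_continuous | exact: cB']].
have cont2 : rcontinuous_on t0 (t0 + r) (fun t => E t - (2 / c) * B t + 2 * e).
  by move=> t tt; apply: continuousD; [exact: cont1 | exact: cst_continuous].
have cont3 : rcontinuous_on t0 (t0 + r) (fun t => 2 * K * (E t - (2 / c) * B t + 2 * e)).
  by move=> t tt; apply: continuousM; [exact: cst_continuous | exact: cont2].
have cont4 : rcontinuous_on t0 (t0 + r) (fun t => 2 * K * (E t - (2 / c) * B t + 2 * e) + Q t).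
  by move=> t tt; apply: continuousD; [exact: cont3 | exact: cQ].
have cont0 : rcontinuous_on t0 (t0 + r) (fun t => (2 / c) * B t).
  by move=> t tt; apply: continuousM; [exact: cst_continuous | exact: cB'].
have cN : rcontinuous_on t0 (t0 + r) (fun t => cn (shifted w t%:C) ^+ 2).
  have -> : (fun t => cn (shifted w t%:C) ^+ 2) = (fun t => 2 * (E t * E t) + Q t).
    by apply/funext => t; rewrite sqr_cn /Q /E expr2 ReM; ring.
  move=> t tt; apply: continuousD; last exact: cQ.
  by apply: continuousM; [exact: cst_continuous | apply: continuousM; exact: cE].
apply: (@le_trans _ _ (rint (fun t => 2 * K * (E t - (2 / c) * B t + 2 * e) + Q t) t0 (t0 + r))).
  apply: ler_rint => // t _.
  have -> : cn (shifted w t%:C) ^+ 2 = 2 * (E t * E t) + Q t.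
    by rewrite sqr_cn /Q /E expr2 ReM; ring.
  rewrite lerD2r -mulrA ler_pM2l //.
  have EK : `|E t| <= K by apply: (le_trans (ler_Im_cn _)); apply: HK.
  have -> : E t * E t = `|E t| * `|E t| by rewrite -normrM ger0_norm // -expr2 sqr_ge0.
  apply: ler_pM => //.
  have Bc : B t / c <= e by rewrite ler_pdivrMr // mulrC; apply: Hc.
  have BE : B t / c <= E t by rewrite ler_pdivrMr // mulrC; apply: Im_stretch_le.
  have -> : 2 / c * B t = 2 * (B t / c) by rewrite mulrAC mulrA.
  by apply: norm_le_sub => //; exact: ltW.
rewrite rintD // rintZ // rintD //; last exact: rcontinuous_cst.
rewrite rint_cst // rintB // rintZ // (_ : t0 + r - t0 = r); last by rewrite addrAC subrr add0r.
have c2 : 0 <= 2 / c <= 2.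
  by rewrite divr_ge0 ?(ltW c0) //= ler_pdivrMr // ler_peMr.
have hB : - (2 * (e * r)) <= 2 / c * rint B t0 (t0 + r).
  case/andP: c2 => c20 c22; rewrite lerNl -mulrN.
  apply: (@le_trans _ _ (2 / c * `|rint B t0 (t0 + r)|)).
    by rewrite ler_wpM2l // -normrN ler_norm.
  by apply: ler_pM.
have hE := le_trans (ler_norm _) rI; have hQ := le_trans (ler_norm _) rQ.
apply: (@le_trans _ _ (2 * K * (e * r + 2 * (e * r) + 2 * e * r) + e * r)).
  apply: lerD => //; rewrite ler_pM2l ?mulr_gt0 //; lra.
have -> : eta * r = e * (14 * K + 1) * r by rewrite divfK // lt0r_neq0.
have h : 0 <= K * (e * r).
  by apply: mulr_ge0; [exact: ltW | apply: mulr_ge0 => //; exact: ltW].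
lra.
Qed.

(** * Finite nets in compact sets and continuity in the translation parameter *)

(** Real translations preserve heights, and Im f stays bounded along them, so the Lipschitz constant
    can be taken independent of [t]. *)
Lemma shifted_equicontinuous w (d : R) : upper_half_space R n w -> 0 < d ->
  exists2 rho, 0 < rho & forall w', coord_le (w' - w) rho ->
    forall t : R, cn (shifted w' t%:C - shifted w t%:C) < d.
Proof.
move=> Hw d0; have [m m0 Hm] := half_space_min Hw.
have [K K0 HK] := shifted_bounded Hw.
pose L := K + cn (tangent w).
have L0 : 0 < L by rewrite ltr_wpDr ?cn_ge0.
have fL t : complex.Im (f (w - const_mx t%:C)) <= L.
  have := le_trans (le_trans (ler_norm _) (ler_Im_cn _)) (HK t%:C (lexx 0)).
  by have := le_trans (ler_norm _) (ler_Im_cn (tangent w)); rewrite Im_shifted /L; lra.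
pose A := \sum_j cn (diag_partial j 'i).
have A0 : 0 <= A by apply: sumr_ge0 => j _; exact: cn_ge0.
pose C := 10 * L / m + A + 1.
have C0 : 0 < C by rewrite ltr_wpDl // addr_ge0 // divr_ge0 ?(ltW m0) // mulr_ge0 // ltW.
pose rho := Num.min (m / 8) (d / (C + 1)).
have rho0 : 0 < rho by rewrite lt_min !divr_gt0 // addr_gt0.
have [rm rd] : rho <= m / 8 /\ rho <= d / (C + 1) by rewrite !ge_min !lexx orbT.
exists rho => // w' Hw' t.
have tD : cn (tangent (w' - w)) <= A * rho.
  rewrite /tangent /A mulr_suml; elim/big_ind2: _ => [|x u y v hx hy|j _].
  - by rewrite cn0.
  - by apply: (le_trans (cnD _ _)); apply: lerD.
  - by rewrite cnM ler_wpM2l ?cn_ge0.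
have E : w' - const_mx t%:C = (w - const_mx t%:C) + (w' - w).
  by apply/rowP => j; rewrite !mxE; ring.
have -> : shifted w' t%:C - shifted w t%:C =
    (f (w - const_mx t%:C + (w' - w)) - f (w - const_mx t%:C)) - tangent (w' - w).
  by rewrite /shifted /defect E [tangent (_ + (w' - w))]tangentD; ring.
have lip := @half_space_lipschitz (w - const_mx t%:C) (w' - w) m rho m0.
have {}lip := lip _ (ltW rho0) Hw' rm.
apply: (@le_lt_trans _ _ (rho * C)).
  apply: (le_trans (cnB _ _)); apply: (@le_trans _ _ (10 * rho / m * L + A * rho)).
    apply: lerD => //; apply: (le_trans (lip _)); last first.
      by rewrite ler_wpM2l // divr_ge0 ?(ltW m0) // mulr_ge0 // ltW.
    by move=> j; rewrite !mxE ImB /= subr0.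
  have -> : 10 * rho / m * L = rho * (10 * L / m) by ring.
  by rewrite /C; lra.
have C1 : 0 < C + 1 by rewrite addr_gt0.
by move: rd; rewrite (ler_pdivlMr _ _ C1); lra.
Qed.

(** Reduces uniform closeness on [K] to finitely many points, to which [mean_square] applies one by
    one; the same net serves all [t]. *)
Lemma shifted_net (K : set 'rV[R[i]]_n) (d : R) : compact K -> K `<=` upper_half_space R n ->
  0 < d -> exists2 ws : seq 'rV[R[i]]_n, (forall w, w \in ws -> upper_half_space R n w) &
    forall w', K w' -> exists2 w, w \in ws &
      forall t : R, cn (shifted w' t%:C - shifted w t%:C) < d.
Proof.
move=> cK KH d0.
pose V w := [set w' | forall t : R, cn (shifted w' t%:C - shifted w t%:C) < d].
have cov : K `<=` cover K (fun w => interior (V w)).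
  move=> w Kw; exists w => //.
  have [rho rho0 Hr] := shifted_equicontinuous (KH w Kw) d0.
  apply: filterS (nbhs_box w rho0) => w' /= Hw'; apply: Hr => j.
  by rewrite !mxE; exact: ltW.
rewrite compact_cover in cK.
have [D DK Dcov] := cK _ K (fun w => interior (V w)) (fun w _ => open_interior _) cov.
exists (finmap.enum_fset D) => [w wD|w' Kw'].
  by apply: KH; have := DK w wD; rewrite inE.
have [w wD Vw] := Dcov w' Kw'.
by exists w => //; exact: (interior_subset Vw).
Qed.

(** One continuous function controls all points of the net, so a single use of Markov's inequality
    is enough. *)
Definition sum_sq ws (t : R) : R := \sum_(w <- ws) cn (shifted w t%:C) ^+ 2.

Lemma sum_sq_continuous ws (a b : R) : (forall w, w \in ws -> upper_half_space R n w) ->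
  rcontinuous_on a b (sum_sq ws).
Proof.
elim: ws => [|w ws IH] Hws.
  by rewrite (_ : sum_sq _ = fun=> 0); [exact: rcontinuous_cst | apply/funext => t; rewrite /sum_sq big_nil].
have -> : sum_sq (w :: ws) = (fun t => (complex.Re (shifted w t%:C) * complex.Re (shifted w t%:C) +
    complex.Im (shifted w t%:C) * complex.Im (shifted w t%:C)) + sum_sq ws t).
  by apply/funext => t; rewrite /sum_sq big_cons sqr_cn !expr2.
have cw := @pcont_shifted _ a b (Hws w (mem_head _ _)).
have cR := pcont_on_Re cw; have cI := pcont_on_Im cw.
have IH' : rcontinuous_on a b (sum_sq ws).
  by apply: IH => v vws; apply: Hws; rewrite inE vws orbT.
move=> t tt; apply: continuousD; last exact: IH'.
by apply: continuousD; apply: continuousM; (exact: cR || exact: cI).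
Qed.

Lemma mean_sum_sq ws : (forall w, w \in ws -> upper_half_space R n w) ->
  forall eta : R, 0 < eta -> exists2 r0 : R, 0 < r0 & forall r t0, r0 <= r ->
    rint (sum_sq ws) t0 (t0 + r) <= eta * r.
Proof.
elim: ws => [|w ws IH] Hws eta eta0.
  exists 1 => // r t0 r1; rewrite (_ : sum_sq _ = fun=> 0); last by apply/funext => t; rewrite /sum_sq big_nil.
  by rewrite rint_cst ?mul0r ?mulr_ge0 ?(ltW eta0) // ?lerDl (le_trans ler01).
have Hws' v : v \in ws -> upper_half_space R n v.
  by move=> vws; apply: Hws; rewrite inE vws orbT.
have eta2 : 0 < eta / 2 by rewrite divr_gt0.
have [r1 r10 H1] := IH Hws' _ eta2.
have Hw : upper_half_space R n w := Hws w (mem_head _ _).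
have [r2 r20 H2] := mean_square Hw eta2.
exists (Num.max r1 r2) => [|r t0]; first by rewrite lt_max r10.
rewrite ge_max => /andP[/(H1 _ t0) h1 /(H2 _ t0) h2].
have -> : sum_sq (w :: ws) = (fun t => sum_sq [:: w] t + sum_sq ws t).
  by apply/funext => t; rewrite /sum_sq !big_cons big_nil addr0.
have e1 : (fun t => cn (shifted w t%:C) ^+ 2) = sum_sq [:: w].
  by apply/funext => t; rewrite /sum_sq !big_cons big_nil addr0.
rewrite e1 in h2.
rewrite rintD; last 2 first.
- by apply: sum_sq_continuous => v; rewrite inE => /eqP ->.
- exact: sum_sq_continuous.
by apply: (le_trans (lerD h2 h1)); rewrite -mulrDl -splitr.
Qed.

Lemma sum_sq_ge ws w t : w \in ws -> cn (shifted w t%:C) ^+ 2 <= sum_sq ws t.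
Proof.
elim: ws => // v ws IH; rewrite inE /sum_sq big_cons => /predU1P[->|/IH h].
  by rewrite lerDl sumr_ge0 // => u _; rewrite exprn_ge0 // cn_ge0.
by apply: (le_trans h); rewrite lerDr exprn_ge0 // cn_ge0.
Qed.

Lemma translate_shifted t w : translate f t w = shifted w t%:C + tangent w.
Proof. by rewrite /translate shiftedE raddfN; ring. Qed.

Lemma translate_tangent_near (K : set (upper_half_space R n)) (d : R) : compact K -> 0 < d ->
  exists2 ws, (forall w, w \in ws -> upper_half_space R n w) &
    forall t, sum_sq ws t < (d / 2) ^+ 2 -> forall p, K p ->
      cn (translate f t (set_val p) - tangent (set_val p)) < d.
Proof.
move=> cK d0; have d2 : 0 < d / 2 by rewrite divr_gt0.
have KH : set_val @` K `<=` upper_half_space R n by move=> _ [x _ <-]; exact: set_valP.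
have [ws Hws net] := shifted_net (compact_set_val cK) KH d2.
exists ws => // t small x Kx; rewrite translate_shifted addrK.
have [|w wws Hw] := net (set_val x); first by exists x.
rewrite -[shifted _ _](subrK (shifted w t%:C)) (le_lt_trans (cnD _ _)) // [d]splitr ltrD //.
by rewrite -ltr_sqr ?nnegrE ?cn_ge0 ?(ltW d2) // (le_lt_trans (sum_sq_ge t wws)).
Qed.

(** Makes the set of parameters whose translate lies in [U] open, hence measurable. *)
Lemma translate_continuous (K : set (upper_half_space R n)) (d : R) t0 : compact K -> 0 < d ->
  exists2 e : R, 0 < e & forall t, `|t - t0| < e -> forall p, K p ->
      cn (translate f t (set_val p) - translate f t0 (set_val p)) < d.
Proof.
move=> cK d0; have d3 : 0 < d / 3 by rewrite divr_gt0.
have KH : set_val @` K `<=` upper_half_space R n by move=> _ [x _ <-]; exact: set_valP.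
have [ws Hws net] := shifted_net (compact_set_val cK) KH d3.
have [e e0 He] : exists2 e : R, 0 < e & forall t, `|t - t0| < e -> forall w, w \in ws ->
    cn (shifted w t%:C - shifted w t0%:C) < d / 3.
  elim: ws Hws {net} => [|w ws IH] Hws; first by exists 1.
  have [|e e0 He] := IH; first by move=> v vws; apply: Hws; rewrite inE vws orbT.
  have tt : t0 <= t0 <= t0 by rewrite lexx.
  have [e' e'0 He'] := pcont_shifted (Hws w (mem_head _ _)) tt d3.
  exists (Num.min e e'); first by rewrite lt_min e0.
  move=> t; rewrite lt_min => /andP[te te'] v; rewrite inE => /predU1P[->|vws].
    exact: He'.
  exact: He.
exists e => // t te x Kx; rewrite !translate_shifted.
have [|w wws Hw] := net (set_val x); first by exists x.
have h1 := Hw t; have h2 := Hw t0; have h3 := He t te w wws.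
rewrite [X in cn X](_ : _ = (shifted (set_val x) t%:C - shifted w t%:C) +
  (shifted w t%:C - shifted w t0%:C) - (shifted (set_val x) t0%:C - shifted w t0%:C)); last by ring.
apply: (le_lt_trans (cnB _ _)); apply: (le_lt_trans (lerD (cnD _ _) (lexx _))).
lra.
Qed.

End HalfSpace.

(** * Markov's inequality and the measure estimate *)

Lemma measure_superlevel (R : realType) (q : R -> R) (a b s : R) : 0 < s ->
  rcontinuous_on a b q -> (forall t, 0 <= q t) ->
  measurable (`[a, b] `&` [set t | s <= q t] : set R) /\
  (s%:E * lebesgue_measure (`[a, b] `&` [set t | (s <= q t)%R]) <= (rint q a b)%:E)%E.
Proof.
move=> s0 cq q0; have iq := rcontinuous_integrable cq.
have mq := measurable_int _ iq.
have E : `[a, b]%classic `&` [set t | s <= q t] =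
    `[a, b]%classic `&` [set t | (s%:E <= `|(EFin \o q) t|)%E].
  by apply/seteqP; split => t [ta /=]; rewrite lee_fin ger0_norm.
split.
  apply: measurable_fun_le => //; exact/measurable_EFinP.
rewrite E.
apply: (le_trans (le_integral_abse lebesgue_measure (measurable_itv _) mq s0)).
rewrite /rint /Rintegral fineK; last exact: integrable_fin_num.
by under eq_integral do rewrite /= ger0_norm //.
Qed.

Theorem theorem4p1 (R : realType) (n : nat) (n_gt0 : (0 < n)%N)
    (f : 'rV[R[i]]_n -> R[i])
    (f_holo : holomorphic_on (upper_half_space R n) f)
    (f_half : forall z, upper_half_space R n z -> upper_half_plane R (f z))
    (f_diag : forall l, upper_half_plane R l -> f (const_mx l) = l)
    (eps : R) (eps_gt0 : 0 < eps) :
  let alpha j := partial_derivative f j (const_mx 'i) in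
  let g := fun z : 'rV[R[i]]_n => \sum_(j < n) alpha j * z ord0 j in
  forall U : set (subspace (holomorphic_space R n)),
    U `<=` holomorphic_space R n -> open U ->
    U (sigL (upper_half_space R n) g) ->
  \forall r \near +oo,
    let S := [set t : R | - (r / 2) <= t <= r / 2 /\
                U (sigL (upper_half_space R n) (translate f t))] in
    measurable S /\ (((1 - eps) * r)%:E <= lebesgue_measure S)%E.
Proof.
move=> alpha g U UA oU Ug.
(* Membership in [U] supplies a holomorphic representative [F], equal to g on the half-space, at
   which [compact_open_basis] applies. *)
have [F hF gF] := UA _ Ug.
have UF : U (sigL (upper_half_space R n) F) by rewrite -gF.
have [K [d [cK d0] HU]] := compact_open_basis oU hF UF.
have FE (x : upper_half_space R n) : F (set_val x) = tangent f (set_val x).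
  exact: (esym (congr1 (fun h => h x) gF)).
have [ws Hws Hnear] := translate_tangent_near f_holo f_half f_diag cK d0.
set s := (d / 2) ^+ 2.
have s0 : 0 < s by rewrite exprn_gt0 // divr_gt0.
(* A mean of at most [eps * s] turns, by Markov at level [s], into an exceptional set of measure at
   most [eps * r]. *)
have [r0 r00 Hr0] := mean_sum_sq f_holo f_half f_diag Hws (mulr_gt0 eps_gt0 s0).
pose V := [set t : R | U (sigL (upper_half_space R n) (translate f t))].
have oV : open V.
  rewrite openE => t Vt.
  have [K' [d' [cK' d'0] HU']] := compact_open_basis oU (holomorphic_translate t f_holo) Vt.
  have [e e0 He] := translate_continuous f_holo f_half f_diag t cK' d'0.
  apply/nbhs_normP; exists e => //= t'; rewrite /ball_ /= distrC => te.
  apply: HU'; first exact: holomorphic_translate.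
  exact: He.
exists r0; split; first exact: num_real.
move=> r rr /=; have r_gt0 : 0 < r := lt_trans r00 rr.
set S := (X in measurable X).
have SE : S = `[- (r / 2), r / 2]%classic `&` V.
  by apply/seteqP; split => t; rewrite /= in_itv.
have mS : measurable S.
  by rewrite SE; apply: measurableI => //; exact: open_measurable.
split=> //.
have ab : - (r / 2) + r = r / 2 by rewrite addrC {1}[r]splitr addrK.
have cq := sum_sq_continuous f_holo f_half f_diag (a := - (r / 2)) (b := r / 2) Hws.
have q0 t : 0 <= sum_sq f ws t.
  by apply: sumr_ge0 => w _; rewrite exprn_ge0 // cn_ge0.
have [mB hB] := measure_superlevel s0 cq q0.
set B := (X in measurable X) in mB hB.
(* [B] is where [sum_sq] reaches [s]; at every other parameter of the interval the translate is
   close enough to g on [K] to lie in [U]. *)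
have BS : `[- (r / 2), r / 2]%classic `<=` S `|` B.
  move=> t ti; have [qs|qs] := leP s (sum_sq f ws t); [by right|left].
  rewrite SE; split => //; apply: HU; first exact: holomorphic_translate.
  by move=> x Kx; rewrite FE; exact: Hnear.
have hr : (r%:E <= lebesgue_measure S + lebesgue_measure B)%E.
  have <- : lebesgue_measure (`[- (r / 2), r / 2]%classic : set R) = r%:E.
    apply: (etrans (lebesgue_measure_itv `[- (r / 2), r / 2])).
    rewrite /= lte_fin gtrN ?divr_gt0 // -EFinD opprK -splitr //.
  apply: (@le_trans _ _ (lebesgue_measure (S `|` B))); last exact: measureU2.
  by apply: le_measure => //; rewrite inE; [exact: measurable_itv | exact: measurableU].
have hB' : (lebesgue_measure B <= (eps * r)%:E)%E.
  have := le_trans hB (_ : _ <= (eps * s * r)%:E)%E.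
  rewrite lee_fin -{2}ab Hr0 ?(ltW rr) // => /(_ isT).
  have -> : (eps * s * r)%:E = (s%:E * (eps * r)%:E)%E by rewrite -EFinM; congr EFin; ring.
  by rewrite lee_pmul2l // lte_fin.
have := le_trans hr (leeD2l _ hB'); case: (lebesgue_measure S) => [x| |].
- by rewrite -EFinD !lee_fin mulrBl mul1r lerBlDr.
- by move=> _; exact: leey.
- by rewrite addNye leNgt ltNyr.
Qed.
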